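(* For any partition $\mu\vdash n$, $$(-1)^{n-\ell(\mu)}\, f_\mu=\sum_{\lambda\vdash n}\left[\sum_{\mathrm{sort}(\alpha)=\mu}\ \sum_{T\in\mathrm{MRT}_{\lambda,\alpha}}\mathrm{sign}(T)\right] s_\lambda ,$$ where the second sum is over all strong compositions $\alpha$ with $\mathrm{sort}(\alpha)=\mu$.
   Context: Symmetric functions are over $\mathbb{C}$: $s_\lambda$ is the Schur function, $m_\mu$ the monomial symmetric function, $\omega$ the algebra involution with $\omega(e_\lambda)=h_\lambda$, and $f_\mu:=\omega(m_\mu)$ the forgotten symmetric function. $\ell(\mu)$ is the number of parts of $\mu$. A strong composition is a finite sequence of positive integers; $\mathrm{sort}(\alpha)$ is the partition obtained by writing the parts of $\alpha$ in weakly decreasing order. Young diagrams are drawn in English notation (rows left-justified, longest row at the top). A monotonic ribbon tiling of a partition shape $\lambda$ is a covering of the cells of $\lambda$ by lattice paths, called ribbons, such that each cell of $\lambda$ lies in exactly one ribbon and each ribbon starts on the lower boundary of $\lambda$ (i.e. at the bottom cell of some column of $\lambda$) and proceeds by unit steps up and to the right between adjacent cells of $\lambda$. The size of a ribbon is its number of cells. The sign of a monotonic ribbon tiling $T$ is $\mathrm{sign}(T):=(-1)^k$, where $k$ is the total number of up steps taken by all its ribbons. The type of $T$ is the composition $(\alpha_1,\dots,\alpha_r)$ where $\alpha_i$ is the size of the ribbon starting in the $i$-th leftmost column among the columns containing the start of a ribbon. $\mathrm{MRT}_{\lambda,\alpha}$ is the set of all monotonic ribbon tilings of shape $\lambda$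 and type $\alpha$. *)

(* Defs.v *)
From HB Require Import structures.
From mathcomp Require Import all_boot all_order all_algebra all_fingroup.
From mathcomp Require Import boolp reals complex mpoly zify.

Set Implicit Arguments.
Unset Strict Implicit.
Unset Printing Implicit Defensive.

Import GRing.Theory.
Local Open Scope ring_scope.

(* The specialization x_N := 0, from N.+1 variables to N variables. *)
Definition restr (K : comNzRingType) N (p : {mpoly K[N.+1]}) : {mpoly K[N]} :=
  p \mPo [tuple if unlift ord_max i is Some j then 'X_j else 0 | i < N.+1].

Definition is_symfun (K : comNzRingType) (f : forall N, {mpoly K[N]}) : Prop :=
  [/\ forall N, f N \is symmetric,
      forall N, restr (f N.+1) = f N
    & exists d, forall N, (msize (f N) <= d)%N].

(* The ring of symmetric functions, as the inverse limit of the graded rings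
   of symmetric polynomials in N variables: f N is the symmetric function f
   evaluated at x_0, ..., x_(N-1), 0, 0, ... *)
Record symfun (K : comNzRingType) := SymFun {
  symfun_comp :> forall N, {mpoly K[N]};
  _ : `[< is_symfun symfun_comp >] }.

HB.instance Definition _ K := [isSub for @symfun_comp K].
HB.instance Definition _ K := [Choice of symfun K by <:].

Section SymFunAlgebra.
Variable K : comNzRingType.
Implicit Types f g h : symfun K.

Lemma symfunP f : is_symfun f. Proof. by apply/asboolP; case: f. Qed.

Lemma symfun_ext f g : (forall N, f N = g N) -> f = g.
Proof. by move=> fg; apply/val_inj/functional_extensionality_dep. Qed.

Definition mkSymFun (f : forall N, {mpoly K[N]}) (fP : is_symfun f) :
    symfun K :=
  SymFun (asboolT fP).

Lemma symfun0_subproof : is_symfun (fun N => 0 : {mpoly K[N]}).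
Proof.
split=> [N|N|]; first exact: rpred0; first exact: comp_mpoly0.
by exists 0%N => N; rewrite msize0.
Qed.

Lemma symfun1_subproof : is_symfun (fun N => 1 : {mpoly K[N]}).
Proof.
split=> [N|N|]; first exact: rpred1; first by rewrite /restr rmorph1.
by exists 1%N => N; rewrite msize1.
Qed.

Lemma symfunN_subproof f : is_symfun (fun N => - f N).
Proof.
have [sf rf [d df]] := symfunP f; split=> [N|N|].
  by rewrite rpredN; apply: sf.
  by rewrite -[in RHS]rf /restr comp_mpolyN.
by exists d => N; rewrite msizeN.
Qed.

Lemma symfunD_subproof f g : is_symfun (fun N => f N + g N).
Proof.
have [sf rf [d df]] := symfunP f; have [sg rg [d' dg]] := symfunP g.
split=> [N|N|]; first by rewrite rpredD ?sf ?sg.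
  by rewrite -[in RHS]rf -[in RHS]rg /restr comp_mpolyD.
exists (maxn d d') => N; apply: leq_trans (msizeD_le _ _) _.
by rewrite geq_max !leq_max df dg orbT.
Qed.

Lemma symfunM_subproof f g : is_symfun (fun N => f N * g N).
Proof.
have [sf rf [d df]] := symfunP f; have [sg rg [d' dg]] := symfunP g.
split=> [N|N|]; first by rewrite rpredM ?sf ?sg.
  by rewrite -[in RHS]rf -[in RHS]rg /restr rmorphM.
exists (d + d').+1%N => N; apply: leq_trans (msizeM_le _ _) _.
by rewrite ltnS leq_add.
Qed.

Lemma symfunZ_subproof (a : K) f : is_symfun (fun N => a *: f N).
Proof.
have [sf rf [d df]] := symfunP f; split=> [N|N|]; first by rewrite rpredZ ?sf.
  by rewrite -[in RHS]rf /restr comp_mpolyZ.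
by exists d => N; apply: leq_trans (msizeZ_le _ _) _.
Qed.

Definition symfun0 := mkSymFun symfun0_subproof.
Definition symfun1 := mkSymFun symfun1_subproof.
Definition symfunN f := mkSymFun (symfunN_subproof f).
Definition symfunD f g := mkSymFun (symfunD_subproof f g).
Definition symfunM f g := mkSymFun (symfunM_subproof f g).
Definition symfunZ a f := mkSymFun (symfunZ_subproof a f).

Lemma symfunDA : associative symfunD.
Proof. by move=> f g h; apply: symfun_ext => N; apply: addrA. Qed.
Lemma symfunDC : commutative symfunD.
Proof. by move=> f g; apply: symfun_ext => N; apply: addrC. Qed.
Lemma symfun0D : left_id symfun0 symfunD.
Proof. by move=> f; apply: symfun_ext => N; apply: add0r. Qed.
Lemma symfunND : left_inverse symfun0 symfunN symfunD.
Proof. by move=> f; apply: symfun_ext => N; apply: addNr. Qed.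
Lemma symfunMA : associative symfunM.
Proof. by move=> f g h; apply: symfun_ext => N; apply: mulrA. Qed.
Lemma symfunMC : commutative symfunM.
Proof. by move=> f g; apply: symfun_ext => N; apply: mulrC. Qed.
Lemma symfun1M : left_id symfun1 symfunM.
Proof. by move=> f; apply: symfun_ext => N; apply: mul1r. Qed.
Lemma symfunMDl : left_distributive symfunM symfunD.
Proof. by move=> f g h; apply: symfun_ext => N; apply: mulrDl. Qed.
Lemma symfun1_neq0 : symfun1 != symfun0.
Proof.
apply/eqP=> /(congr1 (fun f : symfun K => f 0%N)) /= /eqP.
by rewrite oner_eq0.
Qed.
Lemma symfunZA a b f : symfunZ a (symfunZ b f) = symfunZ (a * b) f.
Proof. by apply: symfun_ext => N; apply: scalerA. Qed.
Lemma symfun1Z : left_id 1 symfunZ.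
Proof. by move=> f; apply: symfun_ext => N; apply: scale1r. Qed.
Lemma symfunZDr : right_distributive symfunZ symfunD.
Proof. by move=> a f g; apply: symfun_ext => N; apply: scalerDr. Qed.
Lemma symfunZDl f : {morph symfunZ^~ f : a b / a + b >-> symfunD a b}.
Proof. by move=> a b; apply: symfun_ext => N; apply: scalerDl. Qed.
Lemma symfunZAl a f g : symfunZ a (symfunM f g) = symfunM (symfunZ a f) g.
Proof. by apply: symfun_ext => N; apply: scalerAl. Qed.

HB.instance Definition _ := GRing.isZmodule.Build (symfun K)
  symfunDA symfunDC symfun0D symfunND.
HB.instance Definition _ := GRing.Zmodule_isComNzRing.Build (symfun K)
  symfunMA symfunMC symfun1M symfunMDl symfun1_neq0.
HB.instance Definition _ := GRing.Zmodule_isLmodule.Build K (symfun K)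
  symfunZA symfun1Z symfunZDr symfunZDl.
HB.instance Definition _ :=
  GRing.Lmodule_isLalgebra.Build K (symfun K) symfunZAl.
HB.instance Definition _ := GRing.Lalgebra_isComAlgebra.Build K (symfun K).

End SymFunAlgebra.

Local Notation "m # s" := [multinom m (s i) | i < _]
  (at level 40, left associativity).

Section SymFunCoeff.
Variable K : comNzRingType.

Lemma mcoeff_restr N (p : {mpoly K[N.+1]}) m :
  (restr p)@_m = p@_(mnmwiden m).
Proof.
rewrite /restr comp_mpolyEX [p in RHS]mpolyE !raddf_sum /=.
apply: eq_bigr => m' _; rewrite !mcoeffZ mcoeffX; congr (_ * _).
rewrite comp_mpolyX big_ord_recr /= tnth_mktuple unlift_none.
under eq_bigr => i _.
  rewrite tnth_mktuple (_ : widen_ord _ i = lift ord_max i); last first.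
    by apply: val_inj; rewrite /= /bump leqNgt ltn_ord.
  rewrite liftK; over.
have [m'0|m'N0] := eqVneq (m' ord_max) 0%N; last first.
  rewrite expr0n (negPf m'N0) mulr0 mcoeff0.
  by case: eqP => // m'E; case/eqP: m'N0; rewrite m'E mnmwiden_ordmax.
rewrite m'0 expr0 mulr1.
have m'E : m' = mnmwiden [multinom m' (lift ord_max i) | i < N].
  apply/mnmP => i; case: (unliftP ord_max i) => [j|] ->.
    rewrite -[lift _ j in RHS](_ : widen_ord (leqnSn N) j = _).
      by rewrite mnmwiden_widen mnmE.
    by apply: val_inj; rewrite /= /bump leqNgt ltn_ord.
  by rewrite mnmwiden_ordmax.
rewrite [in RHS]m'E (inj_eq (@inj_mnmwiden _)) -mcoeffX; congr (_@__).
by rewrite mpolyXE_id; apply: eq_bigr => i _; rewrite mnmE.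
Qed.

Lemma msize_leq_coef N d (p : {mpoly K[N]}) :
  (forall m, p@_m != 0 -> (mdeg m < d)%N) -> (msize p <= d)%N.
Proof.
move=> pd; rewrite msizeE; apply/bigmax_leqP_seq => m.
by rewrite mcoeff_msupp => /pd.
Qed.

Lemma is_symfun_coeff d (f : forall N, {mpoly K[N]}) :
    (forall N (s : 'S_N) (m : 'X_{1..N}), (f N)@_(m#s) = (f N)@_m) ->
    (forall N m, (f N.+1)@_(mnmwiden m) = (f N)@_m) ->
    (forall N m, (f N)@_m != 0 -> (mdeg m < d)%N) ->
  is_symfun f.
Proof.
move=> symf resf degf; split=> [N|N|].
- by apply/issymP => s; apply/mpolyP => m; rewrite mcoeff_sym.
- by apply/mpolyP => m; rewrite mcoeff_restr.
- by exists d => N; apply/msize_leq_coef/degf.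
Qed.

Lemma mcoeff_sumX N b (P : pred 'X_{1..N}) m :
  (\sum_(m' : 'X_{1..N < b} | P m') 'X_[m'] : {mpoly K[N]})@_m
    = (P m && (mdeg m < b)%N)%:R.
Proof.
rewrite raddf_sum /=; under eq_bigr do rewrite mcoeffX.
have [mb|/negbTE mb] := boolP (mdeg m < b)%N; last first.
  rewrite andbF big1 // => m' _; case: eqP => // mm'.
  by move: (bmdeg m'); rewrite mm' mb.
rewrite andbT; have [Pm|/negbTE Pm] := boolP (P m); last first.
  by rewrite big1 // => m' Pm'; case: eqP => // mm'; rewrite -mm' Pm' in Pm.
rewrite (bigD1 (BMultinom mb)) //= eqxx big1 ?addr0 // => m' /andP[_].
by rewrite bmeqP /= => /negbTE ->.
Qed.

End SymFunCoeff.

Definition elem_poly (K : comNzRingType) N k : {mpoly K[N]} := mesym N K k.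

Definition complete_poly (K : comNzRingType) N k : {mpoly K[N]} :=
  \sum_(m : 'X_{1..N < k.+1} | mdeg m == k) 'X_[m].

Definition mon_poly (K : comNzRingType) N (mu : seq nat) : {mpoly K[N]} :=
  \sum_(m : 'X_{1..N < (sumn mu).+1}
          | sort geq [seq i <- m : seq nat | i != 0%N] == mu) 'X_[m].

Section Generators.
Variable K : comNzRingType.

Lemma perm_eq_mnm N (m : 'X_{1..N}) (s : 'S_N) :
  perm_eq (m#s : 'X_{1..N}) m.
Proof.
apply/tuple_permP; exists s; congr (tval _).
Qed.

Lemma mnmwidenE N (m : 'X_{1..N}) : mnmwiden m = rcons m 0%N :> seq nat.
Proof. by []. Qed.

Lemma mdeg_sumn N (m : 'X_{1..N}) : mdeg m = sumn m.
Proof.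
by rewrite mdegE sumnE big_tuple.
Qed.

Lemma mdeg_widen N (m : 'X_{1..N}) : mdeg (mnmwiden m) = mdeg m.
Proof. by rewrite !mdeg_sumn mnmwidenE sumn_rcons addn0. Qed.

Lemma sumn_filter_neq0 (s : seq nat) : sumn [seq i <- s | i != 0%N] = sumn s.
Proof. by elim: s => //= -[|i] s /= ->. Qed.

Lemma elem_poly_symfun k : is_symfun (fun N => elem_poly K N k).
Proof.
apply: (@is_symfun_coeff _ k.+1) => [N s m|N m|N m].
- by rewrite !mcoeff_mesym mperm_mechar.
- rewrite !mcoeff_mesym /mechar mdeg_widen; congr ((_ && _)%:R).
  apply/forallP/forallP => mP i.
    by have := mP (widen_ord (leqnSn N) i); rewrite mnmwiden_widen.
  case: (unliftP ord_max i) => [j ->|->]; last by rewrite mnmwiden_ordmax.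
  rewrite (_ : lift _ j = widen_ord (leqnSn N) j) ?mnmwiden_widen //.
  by apply: val_inj; rewrite /= /bump leqNgt ltn_ord.
- rewrite mcoeff_mesym /mechar; case: (mdeg m =P k) => [->|_] //=.
  by rewrite eqxx.
Qed.

Lemma mcoeff_complete_poly N k m :
  (complete_poly K N k)@_m = (mdeg m == k)%:R.
Proof.
rewrite (mcoeff_sumX _ _ (fun m : 'X_{1..N} => mdeg m == k)).
by case: eqP => //= ->; rewrite leqnn.
Qed.

Lemma complete_poly_symfun k : is_symfun (fun N => complete_poly K N k).
Proof.
apply: (@is_symfun_coeff _ k.+1) => [N s m|N m|N m];
  rewrite !mcoeff_complete_poly.
- by rewrite mdeg_mperm.
- by rewrite mdeg_widen.
- by case: (mdeg m =P k) => [->|_] //=; rewrite eqxx.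
Qed.

Lemma mcoeff_mon_poly N mu m :
  (mon_poly K N mu)@_m =
    (sort geq [seq i <- m : seq nat | i != 0%N] == mu)%:R.
Proof.
rewrite (mcoeff_sumX _ _ (fun m : 'X_{1..N} =>
  sort geq [seq i <- m : seq nat | i != 0%N] == mu)).
case: eqP => //= <-; rewrite mdeg_sumn ltnS.
rewrite (perm_sumn (permEl (perm_sort _ _))) sumn_filter_neq0 leqnn //.
Qed.

Lemma mon_poly_symfun mu : is_symfun (fun N => mon_poly K N mu).
Proof.
apply: (@is_symfun_coeff _ (sumn mu).+1) => [N s m|N m|N m];
  rewrite !mcoeff_mon_poly.
- congr ((_ == _)%:R); apply/perm_sortP; [by move=> x y; apply: leq_total
   | by move=> y x z xy yz; apply: leq_trans yz xy
   | by move=> x y; rewrite andbC; apply: anti_leq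
   | exact/perm_filter/perm_eq_mnm].
- by rewrite mnmwidenE filter_rcons eqxx.
- case: (sort _ _ =P mu) => [<- _|_]; last by rewrite eqxx.
  by rewrite (perm_sumn (permEl (perm_sort _ _))) sumn_filter_neq0 mdeg_sumn.
Qed.

End Generators.

Record strong_comp (n : nat) := StrongComp {
  strong_comp_seq :> seq nat;
  _ : (0%N \notin strong_comp_seq) && (sumn strong_comp_seq == n) }.

HB.instance Definition _ n := [isSub for @strong_comp_seq n].
HB.instance Definition _ n := [Countable of strong_comp n by <:].

Section StrongCompFinite.
Variable n : nat.

Lemma strong_compP (al : strong_comp n) :
  0%N \notin (al : seq nat) /\ sumn al = n.
Proof. by case: al => s /= /andP[? /eqP]. Qed.

Lemma size_le_sumn (s : seq nat) : 0%N \notin s -> (size s <= sumn s)%N.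
Proof.
elim: s => //= a s IHs; rewrite inE negb_or => /andP[a0 /IHs le].
by rewrite -add1n leq_add // lt0n eq_sym.
Qed.

Lemma mem_le_sumn (s : seq nat) a : a \in s -> (a <= sumn s)%N.
Proof.
elim: s => //= b s IHs; rewrite inE => /predU1P[->|/IHs le].
  exact: leq_addr.
exact: leq_trans le (leq_addl _ _).
Qed.

Lemma size_strong_comp (al : strong_comp n) : (size al <= n)%N.
Proof.
by have [/size_le_sumn le aln] := strong_compP al; rewrite aln in le.
Qed.

Lemma strong_comp_le (al : strong_comp n) a :
  a \in (al : seq nat) -> (a <= n)%N.
Proof. by have [_ aln] := strong_compP al => /mem_le_sumn; rewrite aln. Qed.

Definition strong_comp_code (al : strong_comp n) : n.-bseq 'I_n.+1 :=
  insub_bseq n [seq inord a | a <- al : seq nat].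

Definition strong_comp_decode (s : n.-bseq 'I_n.+1) : option (strong_comp n) :=
  insub [seq val a | a <- s : seq 'I_n.+1].

Lemma strong_comp_codeK : pcancel strong_comp_code strong_comp_decode.
Proof.
move=> al; rewrite /strong_comp_decode /strong_comp_code /insub_bseq.
rewrite insubdK; last by rewrite -topredE /= size_map size_strong_comp.
rewrite -map_comp map_id_in ?valK // => a /strong_comp_le le.
by rewrite /= inordK.
Qed.

HB.instance Definition _ : isFinite (strong_comp n) :=
  PCanIsFinite strong_comp_codeK.
End StrongCompFinite.

Record intpart (n : nat) := IntPart {
  intpart_comp :> strong_comp n;
  _ : sorted geq intpart_comp }.

HB.instance Definition _ n := [isSub for @intpart_comp n].
HB.instance Definition _ n := [Finite of intpart n by <:].

Lemma intpart_sorted n (la : intpart n) : sorted geq la.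
Proof. by case: la. Qed.

(* Young diagrams in English notation: row i (from the top) has cells
   (i, 0), ..., (i, la_i - 1). *)
Definition cell (la : seq nat) := {i : 'I_(size la) & 'I_(nth 0%N la i)}.
Definition crow la (c : cell la) : nat := tag c.
Definition ccol la (c : cell la) : nat := tagged c.

Definition semistandard la N (T : {ffun cell la -> 'I_N}) :=
  [forall c, forall d,
      ((crow c == crow d) && (ccol c <= ccol d)%N ==> (T c <= T d)%N)
   && ((ccol c == ccol d) && (crow c < crow d)%N ==> (T c < T d)%N)].

Definition schur_poly (K : comNzRingType) N (la : seq nat) : {mpoly K[N]} :=
  \sum_(T : {ffun cell la -> 'I_N} | semistandard T) \prod_c 'X_(T c).

Section Schur.
Variable la : seq nat.

Lemma cell_inj (c d : cell la) : crow c = crow d -> ccol c = ccol d -> c = d.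
Proof.
case: c d => [i j] [i' j']; rewrite /crow /ccol /= => /val_inj ii'.
by case: i' / ii' j' => j' /val_inj ->.
Qed.

Lemma ltn_ccol (c : cell la) : (ccol c < nth 0%N la (crow c))%N.
Proof. by case: c => i j; rewrite /crow /ccol /=. Qed.

Lemma mkcell r j : (j < nth 0%N la r)%N ->
  {c : cell la | crow c = r /\ ccol c = j}.
Proof.
move=> jr; have rs : (r < size la)%N.
  by rewrite ltnNge; apply: contraL jr => /(nth_default 0%N) ->.
by exists (Tagged (fun i : 'I_(size la) => 'I_(nth 0%N la i))
  (i := Ordinal rs) (Ordinal jr)).
Qed.

(* Row-wise encoding of a filling: a r k cells of row r have entry < k. *)
Definition encodes N (T : {ffun cell la -> 'I_N}) (a : nat -> nat -> nat) :=
  forall c k, (T c < k)%N = (ccol c < a (crow c) k)%N.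

Definition interlacing (a : nat -> nat -> nat) :=
  [/\ forall r k, (a r k <= nth 0%N la r)%N,
      forall r k, (a r k <= a r k.+1)%N
    & forall r k, (a r.+1 k.+1 <= a r k)%N].

Lemma encodes_inj N (T U : {ffun cell la -> 'I_N}) a :
  encodes T a -> encodes U a -> T = U.
Proof.
move=> Ta Ua; apply/ffunP => c; apply/val_inj/eqP; rewrite eqn_leq.
by rewrite -ltnS Ta -Ua leqnn -ltnS Ua -Ta ltnSn.
Qed.

Lemma encodes_fun N (T : {ffun cell la -> 'I_N}) a b :
    encodes T a -> encodes T b -> interlacing a -> interlacing b ->
  forall r k, a r k = b r k.
Proof.
move=> Ta Tb [ale _ _] [ble _ _] r k.
have key x y : (x <= nth 0%N la r)%N ->
    (forall c : cell la, crow c = r -> (ccol c < x)%N = (ccol c < y)%N) ->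
    (x <= y)%N.
  case: x => // x /mkcell[c [cr cj]] /(_ c cr); rewrite cj ltnSn.
  by move=> <-.
apply/eqP; rewrite eqn_leq; apply/andP.
by split; apply: key => // c <-; rewrite -Ta -Tb.
Qed.

Lemma encodes_semistandard N (T : {ffun cell la -> 'I_N}) a :
  encodes T a -> interlacing a -> semistandard T.
Proof.
move=> Ta [ale amono ast]; apply/forallP => c; apply/forallP => d.
apply/andP; split; apply/implyP => /andP[/eqP cd lecd].
  by rewrite -ltnS Ta (leq_ltn_trans lecd) // cd -Ta ltnSn.
rewrite Ta cd; have : (ccol d < a (crow d) (T d).+1)%N by rewrite -Ta ltnSn.
move=> /leq_trans; apply; rewrite -(subnKC lecd).
elim: (_ - _)%N => [|m IHm]; first by rewrite addn0.
by rewrite addnS (leq_trans _ IHm) // (leq_trans (ast _ _)).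
Qed.

Hypothesis la_part : sorted geq la.

Lemma nth_part r : (nth 0%N la r.+1 <= nth 0%N la r)%N.
Proof.
have [rs|sr] := ltnP r.+1 (size la); last by rewrite nth_default.
by move/(sortedP 0%N): la_part => /(_ _ rs).
Qed.

Definition tab_code N (T : {ffun cell la -> 'I_N}) r k : nat :=
  \max_(c : cell la | (crow c == r) && (T c < k)%N) (ccol c).+1.

Lemma semistandard_encodes N (T : {ffun cell la -> 'I_N}) :
  semistandard T -> encodes T (tab_code T) /\ interlacing (tab_code T).
Proof.
move=> ssT.
have rowT c d :
    crow c = crow d -> (ccol c <= ccol d)%N -> (T c <= T d)%N.
  move=> cd le; move/forallP: ssT => /(_ c)/forallP/(_ d)/andP[/implyP H _].
  by apply: H; rewrite cd eqxx.
have colT c d : ccol c = ccol d -> (crow c < crow d)%N -> (T c < T d)%N.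
  move=> cd le; move/forallP: ssT => /(_ c)/forallP/(_ d)/andP[_ /implyP H].
  by apply: H; rewrite cd eqxx.
have enc : encodes T (tab_code T).
  move=> c k; apply/idP/idP => [Tck|].
    by apply: (bigmax_sup c) => //; rewrite eqxx.
  rewrite ltnNge; apply: contraNT => /negbTE Tck.
  apply/bigmax_leqP => d /andP[/eqP dc Tdk]; rewrite ltnNge.
  by apply/negP => /(rowT c d (esym dc)) le;
    rewrite (leq_ltn_trans le Tdk) in Tck.
split=> //; split=> r k.
- by apply/bigmax_leqP => c /andP[/eqP <- _]; apply: ltn_ccol.
- apply/bigmax_leqP => c /andP[cr Tc]; apply: (bigmax_sup c) => //.
  by rewrite cr ltnW.
- apply/bigmax_leqP => d /andP[/eqP dr Tdk].
  have /mkcell[c [cr cd]] : (ccol d < nth 0%N la r)%N.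
    by apply: leq_trans (nth_part r); rewrite -dr ltn_ccol.
  rewrite -cd -cr -enc; rewrite ltnS in Tdk; apply: leq_trans Tdk.
  by apply: colT => //; rewrite cr dr.
Qed.

(* Number of cells with entry < k. *)
Lemma card_encodes N (T : {ffun cell la -> 'I_N}) a k :
    encodes T a -> interlacing a ->
  #|[pred c | (T c < k)%N]| = (\sum_(r < size la) a r k)%N.
Proof.
move=> Ta [ale _ _]; rewrite -sum1_card.
under eq_bigl => c do rewrite inE Ta.
rewrite big_mkcond /=.
have /= <- := sig_big_dep predT (fun=> predT)
  (fun (i : 'I_(size la)) (j : 'I_(nth 0%N la i)) =>
     if (j < a i k)%N then 1%N else 0%N).
apply: eq_bigr => i _; rewrite -big_mkcond /=.
by rewrite -(big_ord_widen _ (fun=> 1%N)) // sum1_card card_ord.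
Qed.

(* Bender-Knuth involution exchanging the numbers of i's and i.+1's. *)
Section BenderKnuth.
Variables (N i : nat) (iN : (i.+1 < N)%N).
Implicit Types (a : nat -> nat -> nat) (T : {ffun cell la -> 'I_N}).

Definition bk_hi a r :=
  if r is r'.+1 then minn (a r i.+2) (a r' i) else a r i.+2.
Definition bk_lo a r := maxn (a r.+1 i.+2) (a r i).

Definition bk_code a r k :=
  if k == i.+1 then (bk_hi a r + bk_lo a r - a r i.+1)%N else a r k.

Lemma bk_bounds a r : interlacing a ->
  [&& bk_lo a r <= a r i.+1, a r i.+1 <= bk_hi a r,
      bk_hi a r <= a r i.+2 & a r i <= bk_lo a r]%N.
Proof.
case=> _ amono ast; rewrite /bk_lo /bk_hi.
have := (amono r i, amono r i.+1, ast r i.+1) => -[[/= h1 h2] h3].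
case: r h1 h2 h3 => [|r] h1 h2 h3; first by lia.
by have := ast r i; lia.
Qed.

Lemma bk_interlacing a : interlacing a -> interlacing (bk_code a).
Proof.
move=> aP; have [ale amono ast] := aP; split=> r k; rewrite /bk_code.
- by case: eqP => // _; have := bk_bounds r aP; have := ale r i.+2; lia.
- have := bk_bounds r aP; have := amono r k.
  by case: eqP => [->|_]; case: eqP => [|_]; [lia | lia | case=> -> | ]; lia.
- have := bk_bounds r aP; have := bk_bounds r.+1 aP; have := ast r k.
  rewrite /bk_lo /bk_hi eqSS; case: (k =P i) => [->|ki].
    by rewrite ltn_eqF //; lia.
  by case: (k =P i.+1) => [->|//]; lia.
Qed.

Lemma bk_codeK a : interlacing a -> forall r k, bk_code (bk_code a) r k = a r k.
Proof.
move=> aP r k; have := bk_bounds r aP; rewrite /bk_code.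
rewrite /bk_hi /bk_lo !eqxx !(ltn_eqF (leqnn _)) !(gtn_eqF (leqnn _)).
by case: eqP => [->|//]; case: r => [|r]; lia.
Qed.

Definition bk_fun T : {ffun cell la -> 'I_N} :=
  let a := tab_code T in
  [ffun c => if (ccol c < a (crow c) i)%N then T c
             else if (ccol c < bk_code a (crow c) i.+1)%N then Ordinal (ltnW iN)
             else if (ccol c < a (crow c) i.+2)%N then Ordinal iN
             else T c].

Lemma eq_bk_code a b : (forall r k, a r k = b r k) ->
  forall r k, bk_code a r k = bk_code b r k.
Proof. by move=> ab [|r] k; rewrite /bk_code /bk_hi /bk_lo !ab. Qed.

Lemma leq_code a r k l : interlacing a -> (k <= l)%N -> (a r k <= a r l)%N.
Proof.
move=> [_ amono _] kl; rewrite -(subnKC kl); elim: (l - k)%N => [|m].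
  by rewrite addn0.
by rewrite addnS => /leq_trans; apply.
Qed.

Lemma bk_encodes T :
  semistandard T -> encodes (bk_fun T) (bk_code (tab_code T)).
Proof.
move=> /semistandard_encodes[Ta aP] c k; rewrite ffunE.
have bkP := bk_bounds (crow c) aP.
have e0 := Ta c k; have e1 := Ta c i; have e2 := Ta c i.+2.
have mono l l' := @leq_code (tab_code T) (crow c) l l' aP.
move: (tab_code T) e0 e1 e2 aP bkP mono => a e0 e1 e2 aP bkP mono.
rewrite /bk_code eqxx in e0 *.
have [ki|ki|->] := ltngtP k i.+1; rewrite -?e0 //=.
- case: ifP => // h1; have hk := mono k i; case: ifP => /= h2; first by lia.
  by case: ifP => /= h3; lia.
- have hk := mono i.+2 k ki; case: ifP => // h1.
  by case: ifP => /= h2; [lia | case: ifP => /= h3; lia].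
- case: ifP => /= h1; first by lia.
  by case: ifP => /= h2; [lia | case: ifP => /= h3; lia].
Qed.

Lemma bk_semistandard T : semistandard T -> semistandard (bk_fun T).
Proof.
move=> ssT; apply: encodes_semistandard (bk_encodes ssT) _.
by apply: bk_interlacing; case: (semistandard_encodes ssT).
Qed.

Lemma bk_funK T : semistandard T -> bk_fun (bk_fun T) = T.
Proof.
move=> ssT; have [Ta aP] := semistandard_encodes ssT.
have ssU := bk_semistandard ssT; have [Ub bP] := semistandard_encodes ssU.
have E := encodes_fun Ub (bk_encodes ssT) bP (bk_interlacing aP).
apply: encodes_inj Ta => c k; rewrite (bk_encodes ssU) -(bk_codeK aP).
by congr (_ < _)%N; apply: eq_bk_code.
Qed.

Lemma bk_sum a : interlacing a ->
  (\sum_(r < size la) bk_code a r i.+1 + \sum_(r < size la) a r i.+1 =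
   \sum_(r < size la) a r i.+2 + \sum_(r < size la) a r i)%N.
Proof.
move=> aP; rewrite -!big_split /=.
under eq_bigr => r _.
  rewrite /bk_code eqxx subnK; last by have := bk_bounds r aP; lia.
  over.
have aS : forall k, a (size la) k = 0%N.
  by case: aP => ale _ _ k; apply/eqP;
    rewrite -leqn0 -(@nth_default _ 0%N la (size la)).
suff key n : (\sum_(r < n) (bk_hi a r + bk_lo a r) + bk_hi a n =
    \sum_(r < n) (a r i.+2 + a r i) + a n i.+2)%N.
  have := key (size la); rewrite aS addn0 => <-.
  have := bk_bounds (size la) aP; rewrite !aS => hi0.
  suff -> : bk_hi a (size la) = 0%N by rewrite addn0.
  by lia.
elim: n => [|n IHn]; first by rewrite !big_ord0.
rewrite !big_ord_recr /=; move: IHn; rewrite /bk_lo /=; lia.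
Qed.

Lemma card_eq_encodes T a k : encodes T a -> interlacing a ->
  (#|[pred c | T c == k :> nat]| + \sum_(r < size la) a r k =
   \sum_(r < size la) a r k.+1)%N.
Proof.
move=> Ta aP; rewrite -!(card_encodes _ Ta aP) addnC.
rewrite -(cardID [pred c | (T c < k)%N] [pred c | (T c < k.+1)%N]).
by congr (_ + _)%N; apply: eq_card => c; rewrite !inE; lia.
Qed.

Let s := tperm (Ordinal (ltnW iN)) (Ordinal iN).

Lemma bk_card T k : semistandard T ->
  #|[pred c | bk_fun T c == k]| = #|[pred c | T c == s k]|.
Proof.
move=> ssT; have [Ta aP] := semistandard_encodes ssT.
have bP := bk_interlacing aP; have Tb := bk_encodes ssT.
have cT l := card_eq_encodes l Ta aP; have cb l := card_eq_encodes l Tb bP.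
have bs := bk_sum aP.
have bkE l : l != i.+1 -> (\sum_(r < size la) bk_code (tab_code T) r l =
    \sum_(r < size la) tab_code T r l)%N.
  by move=> /negbTE li; apply: eq_bigr => r _; rewrite /bk_code li.
have ar1 x y A B C A' :
  (A' + B = C + A -> x + A = A' -> y + B = C -> x = y)%N by lia.
have ar2 x y A B C A' :
  (A' + B = C + A -> x + A' = C -> y + A = B -> x = y)%N by lia.
have := (cb i, cb i.+1); rewrite (bkE i) ?(bkE i.+2); try lia.
move=> -[cb0 cb1]; rewrite /s; case: tpermP => [->|->|].
- exact: ar1 bs cb0 (cT i.+1).
- exact: ar2 bs cb1 (cT i).
- move=> /eqP; rewrite -val_eqE /= => ki /eqP; rewrite -val_eqE /= => ki1.
  have := cb k; rewrite (bkE k) // (bkE k.+1) // -(cT k).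
  exact: addIn.
Qed.

End BenderKnuth.

End Schur.

Section SchurSymmetric.
Variables (K : comNzRingType) (la : seq nat).
Hypothesis la_part : sorted geq la.

Lemma schur_poly_adjacent N i (iN : (i.+1 < N)%N) :
  msym (tperm (Ordinal (ltnW iN)) (Ordinal iN)) (schur_poly K N la)
    = schur_poly K N la.
Proof.
set s := tperm _ _; rewrite /schur_poly raddf_sum /=.
pose bk := @bk_fun la N i iN.
have bkK : forall T, semistandard T -> bk (bk T) = T.
  by move=> T; apply: bk_funK.
rewrite [RHS](reindex_onto bk bk) //=; apply: eq_big => T.
  apply/idP/andP => [ssT|[ssT /eqP <-]]; last exact: bk_semistandard.
  by rewrite bkK ?eqxx //; split=> //; apply: bk_semistandard.
move=> ssT; rewrite rmorph_prod /=.
have prodE (U : cell la -> 'I_N) : \prod_c ('X_(U c) : {mpoly K[N]}) =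
    \prod_k 'X_k ^+ #|[pred c | U c == k]|.
  rewrite (partition_big U predT) //=; apply: eq_bigr => k _.
  rewrite (eq_bigr (fun=> 'X_k)) => [|c /eqP -> //].
  by rewrite prodr_const.
transitivity (\prod_c ('X_(s (T c)) : {mpoly K[N]})).
  apply: eq_bigr => c _; rewrite msymX; congr 'X_[_].
  by apply/mnmP => k; rewrite !mnmE tpermV -(inj_eq (@perm_inj _ s)) tpermK.
rewrite !prodE; apply: eq_bigr => k _; rewrite (bk_card la_part) //.
congr (_ ^+ _); apply: eq_card => c; rewrite !inE.
by rewrite -(inj_eq (@perm_inj _ s)) tpermK.
Qed.

Lemma schur_poly_next N (i j : 'I_N) : val j = i.+1 ->
  msym (tperm i j) (schur_poly K N la) = schur_poly K N la.
Proof.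
case: i j => [i iN] [j jN] /= ji; subst j.
by rewrite (bool_irrelevance iN (ltnW jN)) schur_poly_adjacent.
Qed.

Lemma schur_poly_sym N : schur_poly K N la \is symmetric.
Proof.
apply/issymP => s; have [ts -> _] := prod_tpermP s.
set p := schur_poly K N la.
have mulS s1 s2 : msym s1 p = p -> msym s2 p = p -> msym (s1 * s2)%g p = p.
  by move=> p1 p2; rewrite msymMm p1 p2.
have ltS d (i j : 'I_N) : val j = (i + d.+1)%N -> msym (tperm i j) p = p.
  elim: d j => [|d IHd] j.
    by rewrite addn1; apply: schur_poly_next.
  rewrite addnS => jE; have kN : (i + d.+1 < N)%N.
    by have := ltn_ord j; rewrite [nat_of_ord j]jE => /ltnW.
  pose k := Ordinal kN; have jk : msym (tperm k j) p = p.
    exact: schur_poly_next.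
  have ne x y : val x != val y -> (x : 'I_N) != y by [].
  have -> : tperm i j = ((tperm i k) ^ (tperm k j))%g.
    rewrite tpermJ tpermL tpermD //; apply: ne; rewrite /= ?jE; lia.
  rewrite /conjg tpermV; apply: (mulS) => //; apply: (mulS) => //; exact: IHd.
elim: ts => [|[i j] ts IHts]; first by rewrite big_nil msym1m.
rewrite big_cons; apply: (mulS) => //=.
have [ij|ji|/val_inj ->] := ltngtP i j.
- by apply: (ltS (j - i.+1)%N); rewrite /=; lia.
- by rewrite tpermC; apply: (ltS (i - j.+1)%N); rewrite /=; lia.
- by rewrite tperm1 msym1m.
Qed.

Lemma schur_poly_restr N : restr (schur_poly K N.+1 la) = schur_poly K N la.
Proof.
rewrite /schur_poly /restr raddf_sum /=.
pose h (T : {ffun cell la -> 'I_N}) := [ffun c => lift ord_max (T c)].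
rewrite (bigID (fun T : {ffun cell la -> 'I_N.+1} =>
  [forall c, T c != ord_max])) /=.
rewrite addrC big1 ?add0r => [|T /andP[_]]; last first.
  rewrite negb_forall => /existsP[c]; rewrite negbK => /eqP Tc.
  rewrite rmorph_prod (bigD1 c) //= comp_mpolyXU -tnth_nth tnth_mktuple.
  by rewrite Tc unlift_none mul0r.
have h_inj : injective h.
  by move=> T U /ffunP TU; apply/ffunP => c; have := TU c;
    rewrite !ffunE => /lift_inj.
rewrite (reindex_omap h (fun U => [pick T | h T == U])) /=; last first.
  move=> U /andP[_ /forallP UN]; case: pickP => [T /eqP <- //|/=].
  have UN' c : ord_max != U c by rewrite eq_sym.
  move=> /(_ [ffun c => s2val (unlift_some (UN' c))])/eqP[].
  by apply/ffunP => c; rewrite !ffunE; case: unlift_some.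
apply: eq_big => T.
  have -> : [forall c, h T c != ord_max].
    by apply/forallP => c; rewrite ffunE eq_sym neq_lift.
  have -> : [pick T0 | h T0 == h T] == Some T.
    case: pickP => [U /eqP/h_inj -> //|/(_ T)]; by rewrite eqxx.
  rewrite !andbT; apply: eq_forallb => c; apply: eq_forallb => d.
  by rewrite !ffunE !lift_max.
move=> _; rewrite rmorph_prod; apply: eq_bigr => c _ /=.
by rewrite comp_mpolyXU -tnth_nth tnth_mktuple ffunE liftK.
Qed.

Lemma schur_poly_symfun : is_symfun (fun N => schur_poly K N la).
Proof.
split=> [N|N|]; [exact: schur_poly_sym | exact: schur_poly_restr |].
exists #|{: cell la}|.+1 => N; apply: leq_trans (msize_sum _ _ _) _.
apply/bigmax_leqP => T _; rewrite mprodXE msizeX mdeg_sum.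
by under eq_bigr do rewrite mdeg1; rewrite sum1_card.
Qed.

End SchurSymmetric.

Section SymmetricFunctions.
Variable K : comNzRingType.

Definition elementary (la : seq nat) : symfun K :=
  \prod_(k <- la) mkSymFun (elem_poly_symfun K k).

Definition complete (la : seq nat) : symfun K :=
  \prod_(k <- la) mkSymFun (complete_poly_symfun K k).

Definition monomial (mu : seq nat) : symfun K :=
  mkSymFun (mon_poly_symfun K mu).

Definition schur n (la : intpart n) : symfun K :=
  mkSymFun (schur_poly_symfun K (intpart_sorted la)).

(* The conditions that single out the involution omega among the algebra
   endomorphisms of symfun K. *)
Definition is_omega (omega : {lrmorphism symfun K -> symfun K}) : Prop :=
  involutive omega /\
  forall n (la : intpart n), omega (elementary la) = complete la.

Definition forgotten (omega : {lrmorphism symfun K -> symfun K})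
    (mu : seq nat) : symfun K :=
  omega (monomial mu).

End SymmetricFunctions.

Section MonotonicRibbonTilings.
Variable la : seq nat.
Implicit Types (c d : cell la) (p : seq (cell la)).

Definition step_up c d := (crow c == (crow d).+1) && (ccol c == ccol d).
Definition step_right c d := (crow c == crow d) && (ccol d == (ccol c).+1).

Definition column_bottom c :=
  [forall d : cell la, (ccol d == ccol c) ==> (crow d <= crow c)%N].

(* A ribbon is the list of its cells, from its start to its end. *)
Definition is_ribbon p :=
  if p is c :: p' then
    column_bottom c && path [rel c d | step_up c d || step_right c d] c p'
  else false.

Definition up_steps p := count (fun cd => step_up cd.1 cd.2) (zip p (behead p)).

Definition start_column p : nat := head 0%N [seq ccol c | c <- p].

(* The cells of a ribbon are pairwise distinct, so bounding its length by the
   number of cells only serves to have finitely many candidates. *)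
Definition cell_path := #|{: cell la}|.-bseq (cell la).
Definition tiling := {set cell_path}.

Definition is_mrt (T : tiling) :=
  [forall r : cell_path in T, is_ribbon r] &&
  [forall c : cell la, #|[set r : cell_path in T | c \in (r : seq _)]| == 1%N].

(* The order is strict on the ribbons of a tiling, which start in distinct
   columns. *)
Definition mrt_type (T : tiling) : seq nat :=
  [seq size (r : cell_path)
    | r <- sort (fun r s : cell_path => (start_column r <= start_column s)%N)
                (enum T)].

Definition mrt_sign (K : pzRingType) (T : tiling) : K :=
  (-1) ^+ (\sum_(r in T) up_steps r).

Definition MRT (al : seq nat) : {set tiling} :=
  [set T | is_mrt T & mrt_type T == al].

End MonotonicRibbonTilings.

(* Main.v *)
(* Write b for the sequence of column lengths of a partition lambda. The tiling
   sum on the right, with a weight y_k for every ribbon of size k, equals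
   +- det (y_(b_i - i + j)): in a region whose cells lie below a decreasing top
   profile, the leftmost ribbon has to hug the upper left boundary, hence it is
   determined by the column where it ends, and removing it amounts to expanding
   the determinant along its first row. On the other side, s_lambda is the
   determinant det (e_(b_i - i + j)) (both satisfy the same branching rule in
   the number of variables), which omega maps to det (h_(b_i - i + j)). In N
   variables this last determinant is the quotient of the alternants of
   b + delta and delta, and comparing the coefficients of m_mu a_delta with those
   of the weighted determinant gives m_mu as a combination of the
   omega (s_lambda). *)
From HB Require Import structures.
Require Import Defs.
From mathcomp Require Import all_boot all_order all_algebra.
From mathcomp Require Import fingroup perm boolp reals complex mpoly zify ring.

Set Implicit Arguments.
Unset Strict Implicit.
Unset Printing Implicit Defensive.

Import GRing.Theory.
Local Open Scope ring_scope.

(** Weighting a ribbon by its right steps instead of its up steps makes the signs agree with no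
    correction: a ribbon ending [c] columns after its start makes [c] right steps, and (-1)^c is the
    cofactor sign in the first row. A ribbon has one cell more than it has steps, so over a whole
    tiling the two signs differ by (-1)^(n - number of ribbons), which is the sign in front of the
    forgotten function. Removing a ribbon leaves the class of straight shapes; hence the arbitrary
    top profiles [p] and the entries y_(b_a + c - p_c - a), whose minors have the same form for the
    lowered profile. The y_k are independent variables, so that one coefficient selects the tilings
    whose type sorts to mu. Passing from N variables to symmetric functions needs coefficients that
    do not depend on N; this comes for free, since the tiling sum does not see N. *)

(* [y_(u - v)], with [y] extended by [0] to the negative integers. *)
Definition shifted (R : pzRingType) (y : nat -> R) (u v : nat) : R :=
  if (v <= u)%N then y (u - v)%N else 0.

Lemma shiftedSS (R : pzRingType) (y : nat -> R) u v :
  shifted y u.+1 v.+1 = shifted y u v.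
Proof. by rewrite /shifted ltnS subSS. Qed.

(** * Column lengths, and a vanishing criterion for determinants *)

Definition conj_part (la : seq nat) c := count (fun x => c < x)%N la.

(** Both sides say that (r, c) is a cell of the diagram. *)
Lemma ltn_conj_part la r c : sorted geq la ->
  (r < conj_part la c)%N = (c < nth 0%N la r)%N.
Proof.
elim: la r => [|x la IHla] [|r] //= xla; rewrite /conj_part /=.
- have [//|xc] := ltnP c x; rewrite add0n -has_count.
  apply/negbTE/hasPn => z /= zla; rewrite -leqNgt; apply: leq_trans xc.
  have tr : transitive geq by move=> y u v ? /leq_trans; apply.
  by move/(order_path_min tr)/allP: xla => /(_ _ zla).
- rewrite -IHla ?(path_sorted xla) // /conj_part.
  have [_|xc] := ltnP c x; first by rewrite add1n ltnS.
  rewrite add0n; suff /eqP -> : count (fun z => c < z)%N la == 0%N by [].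
  rewrite -leqn0 leqNgt -has_count; apply/hasPn => z /= zla.
  rewrite -leqNgt; apply: leq_trans xc.
  have tr : transitive geq by move=> y u v ? /leq_trans; apply.
  by move/(order_path_min tr)/allP: xla => /(_ _ zla).
Qed.

Lemma conj_part_anti la c d :
  (c <= d)%N -> (conj_part la d <= conj_part la c)%N.
Proof. by move=> cd; apply: sub_count => x /(leq_ltn_trans cd). Qed.

Lemma conj_part_eq0 la N c : sorted geq la -> (head 0%N la <= N <= c)%N ->
  conj_part la c = 0%N.
Proof.
move=> sla /andP[hN Nc]; apply/eqP; rewrite -leqn0 leqNgt ltn_conj_part //.
by rewrite nth0 -leqNgt (leq_trans hN).
Qed.

Section ShiftedDet.
Variables (R : comNzRingType) (y : nat -> R).

(** Every permutation [s] meets a zero entry. The rows from [j] on outnumber the columns after [j],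
    so some [a >= j] has [s a <= j]; then b_a <= b_j < p_j <= p_(s a), and the index of that entry
    is negative. *)
Lemma det_shifted_eq0 m (b p : nat -> nat) j :
    {homo b : c d / (c <= d)%N >-> (d <= c)%N} ->
    {homo p : c d / (c <= d)%N >-> (d <= c)%N} ->
    (j < m)%N -> (b j < p j)%N ->
  \det (\matrix_(a < m, c < m) shifted y (b a + c) (p c + a)) = 0.
Proof.
move=> b_anti p_anti jm bp; rewrite /determinant big1 // => s _.
have [a /andP[ja sa]] : exists a : 'I_m, (j <= a)%N && (s a <= j)%N.
  apply/existsP; apply: contraTT isT; rewrite negb_exists => /forallP sP.
  have sub : s @: [set a : 'I_m | (j <= a)%N] \subset
      [set c : 'I_m | (j < c)%N].
    apply/subsetP => x /imsetP[a]; rewrite inE => ja ->; rewrite inE.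
    by have := sP a; rewrite ja /= -ltnNge.
  have := subset_leq_card sub; rewrite card_imset; last exact: perm_inj.
  suff /proper_card : [set c : 'I_m | (j < c)%N] \proper
      [set a : 'I_m | (j <= a)%N] by rewrite ltnNge => /negbTE ->.
  apply/properP; split; first by apply/subsetP=> c; rewrite !inE => /ltnW.
  by exists (Ordinal jm); rewrite inE /= ?leqnn ?ltnn.
rewrite (bigD1 a) //= mxE /shifted leqNgt ifN ?mul0r ?mulr0 //.
by rewrite negbK; have := b_anti _ _ ja; have := p_anti _ _ sa; lia.
Qed.

End ShiftedDet.

(** * Removing the leftmost ribbon *)

Section Ribbons.
Variable la : seq nat.
Implicit Types (z w v : cell la) (s : seq (cell la)).

Local Notation b := (conj_part la).
Local Notation step := [rel c d : cell la | step_up c d || step_right c d].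

(* The content ccol - crow, shifted so as to stay in nat. *)
Definition content z := (ccol z + (size la - crow z))%N.

Lemma crow_size z : (crow z < size la)%N.
Proof. exact: ltn_ord. Qed.

Lemma step_content z w : step z w -> content w = (content z).+1.
Proof.
rewrite /content; have := crow_size z; have := crow_size w.
by move=> /= h1 h2 /orP[] /andP[/eqP h3 /eqP h4]; lia.
Qed.

Lemma path_content z s k : path step z s -> (k <= size s)%N ->
  content (nth z (z :: s) k) = (content z + k)%N.
Proof.
elim: s z k => [|w s IHs] z [|k]; rewrite ?addn0 //= => /andP[zw ws] ks.
by rewrite (set_nth_default w) // IHs // (step_content zw) addSnnS.
Qed.

Lemma path_content_last z s : path step z s ->
  content (last z s) = (content z + size s)%N.
Proof.
by move=> zs; rewrite -(path_content zs (leqnn _)) -last_nth.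
Qed.

(** Content grows by exactly one at each step, so no intermediate value is skipped. *)
Lemma mem_path_content z s k : path step z s ->
    (content z <= k <= content (last z s))%N ->
  exists2 w, w \in z :: s & content w = k.
Proof.
move=> zs; rewrite path_content_last // => /andP[zk ks].
have ks' : (k - content z <= size s)%N by lia.
exists (nth z (z :: s) (k - content z)); first by rewrite mem_nth //= ltnS.
by rewrite path_content // subnKC.
Qed.

Lemma path_sorted_content z s : path step z s ->
  sorted (relpre content ltn) (z :: s).
Proof. by apply: sub_path => u v /step_content /= ->. Qed.

Lemma content_ltn_trans : transitive (relpre content ltn).
Proof. by move=> x y z; apply: ltn_trans. Qed.

Lemma path_uniq z s : path step z s -> uniq (z :: s).
Proof.
move/path_sorted_content; apply: sorted_uniq; first exact: content_ltn_trans.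
by move=> x /=; rewrite ltnn.
Qed.

Lemma path_content_inj z s : path step z s ->
  {in z :: s &, injective content}.
Proof.
move=> zs u v us vs uv; rewrite -(nth_index z us) -(nth_index z vs).
move: uv; rewrite -{1}(nth_index z us) -{1}(nth_index z vs).
have lt x : x \in z :: s -> (index x (z :: s) <= size s)%N.
  by rewrite -ltnS -[X in (_ < X)%N]/(size (z :: s)) index_mem.
by rewrite !path_content ?lt // => /addnI ->.
Qed.

Lemma path_content_le z s w : path step z s -> w \in z :: s ->
  (content z <= content w <= content (last z s))%N.
Proof.
move=> zs wzs; have iw : (index w (z :: s) <= size s)%N.
  by rewrite -ltnS -[X in (_ < X)%N]/(size (z :: s)) index_mem.
rewrite -(nth_index z wzs) path_content // path_content_last //.
by rewrite leq_addr leq_add2l.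
Qed.

Lemma path_ccol_le z s w : path step z s -> w \in z :: s ->
  (ccol w <= ccol (last z s))%N.
Proof.
elim: s z w => [|u s IHs] z w /=; first by rewrite inE => _ /eqP ->.
move=> /andP[zu us]; rewrite inE => /predU1P[->|/IHs -> //].
apply: leq_trans (IHs u u us (mem_head _ _)).
by case/orP: zu => /andP[/eqP ? /eqP ?]; lia.
Qed.

Lemma path_pred z s w : path step z s -> w \in z :: s ->
  w = z \/ exists2 v, v \in z :: s & step v w.
Proof.
elim: s z w => [|u s IHs] z w /=; first by rewrite inE => _ /eqP ->; left.
move=> /andP[zu us]; rewrite inE => /predU1P[->|]; first by left.
move=> /(IHs _ _ us)[->|[v vs vw]]; right.
  by exists z => //; rewrite inE eqxx.
by exists v => //; rewrite inE vs orbT.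
Qed.

Lemma path_up_steps z s : path step z s ->
  (up_steps (z :: s) + ccol (last z s) = size s + ccol z)%N.
Proof.
elim: s z => [|w s IHs] z //= /andP[zw /IHs].
rewrite /up_steps /= => IH; have hup : (step_up z w + ccol w = (ccol z).+1)%N.
  by case/orP: zw; rewrite /step_up => /andP[/eqP h1 /eqP h2];
    rewrite ?h1 ?h2 ?eqxx //= -?h1; case: eqP => //; lia.
by move: IH hup; set u := count _ _; lia.
Qed.

Lemma path_size_card z s : path step z s -> (size (z :: s) <= #|{: cell la}|)%N.
Proof. by move/path_uniq/card_uniqP <-; apply: max_card. Qed.

Definition right_steps s := ((size s).-1 - up_steps s)%N.

Lemma path_right_steps z s : path step z s ->
  (right_steps (z :: s) + ccol z = ccol (last z s))%N.
Proof.
move=> zs; have := path_up_steps zs; rewrite /right_steps /=.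
have : (ccol z <= ccol (last z s))%N by apply: path_ccol_le (mem_head _ _).
lia.
Qed.

(* In the region formed by the cells of the columns [i], [i.+1], ... lying in
   rows [p c] and below in each column [c], these are the cells of the path
   that starts at the bottom of column [i] and hugs the upper left boundary. *)
Definition hugging i (p : nat -> nat) r c :=
  [&& i <= c, p c <= r & (c == i) || (r <= p c.-1)]%N.

Definition region i (p : nat -> nat) z :=
  (i <= ccol z)%N && (p (ccol z) <= crow z)%N.

(* The top profile after removal of the ribbon hugging the top profile [p] from
   column [i] to column [i + c]. *)
Definition lower i c (p : nat -> nat) j :=
  if (i < j <= i + c)%N then (p j.-1).+1 else p j.

(** All region cells of column [i] hug. In a column [j] with i < j <= i + c the hugging cells are
    the rows from [p j] to [p j.-1], which is what raising the profile to [(p j.-1).+1] cuts off. *)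
Lemma region_lowerE i p c w : region i p w ->
  hugging i p (crow w) (ccol w) && (ccol w <= i + c)%N
    = ~~ region i.+1 (lower i c p) w.
Proof.
rewrite /region /hugging /lower => /andP[ic pw]; rewrite ic pw /=.
move: (p (ccol w).-1) => q; case: ifP => [/andP[ic1 wc]|]; first by lia.
by rewrite pw; lia.
Qed.

Hypothesis la_part : sorted geq la.

Lemma ltn_crow z : (crow z < b (ccol z))%N.
Proof. by rewrite ltn_conj_part // ltn_ccol. Qed.

Lemma cell_at r c : (r < b c)%N -> {z : cell la | crow z = r /\ ccol z = c}.
Proof. by rewrite ltn_conj_part //; apply: mkcell. Qed.

Lemma column_bottomE z : column_bottom z = ((crow z).+1 == b (ccol z)).
Proof.
apply/forallP/eqP => [zP|zb w]; last first.
  by apply/implyP => /eqP wz; have := ltn_crow w; rewrite wz -zb.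
apply/eqP; rewrite eqn_leq ltn_crow leqNgt; apply/negP => lt.
have [w [wr wc]] := cell_at lt.
by have := zP w; rewrite wc eqxx wr ltnn.
Qed.

Definition is_top i (p : nat -> nat) :=
  (forall j, i <= j -> p j.+1 <= p j)%N /\ (forall j, i <= j -> p j <= b j)%N.

Definition hugging_ribbon i p c s :=
  if s is z :: s' then
    [&& path step z s', (crow z).+1 == b i, ccol z == i,
      all (fun w => hugging i p (crow w) (ccol w)) s,
      crow (last z s') == p (i + c)%N & ccol (last z s') == (i + c)%N]
  else false.

Section Hugging.
Variables (i : nat) (p : nat -> nat).
Hypothesis p_top : is_top i p.

Lemma top_anti j k : (i <= j <= k)%N -> (p k <= p j)%N.
Proof.
move=> /andP[ij jk]; rewrite -(subnKC jk); elim: (k - j)%N => [|m IHm].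
  by rewrite addn0.
by rewrite addnS (leq_trans _ IHm) //; case: p_top => -> //; lia.
Qed.

(** A hugging cell is determined by its content: if c < c' then r' <= p (c' - 1) <= p c <= r, so the
    content at column c' is strictly larger. *)
Lemma hugging_inj r c r' c' : hugging i p r c -> hugging i p r' c' ->
  (c + r' = c' + r)%N -> r = r' /\ c = c'.
Proof.
move=> /and3P[ic pr rp] /and3P[ic' pr' rp'] E.
have [cc|cc|cc] := ltngtP c c'; last by lia.
  by have := @top_anti c c'.-1; case/orP: rp' => [/eqP|]; lia.
by have := @top_anti c' c.-1; case/orP: rp => [/eqP|]; lia.
Qed.

(** The bounds [r < b i] and [j <= i + c] put the content of (r, j) between those of the two ends.
    The ribbon has a cell of that content, and [hugging_inj] identifies it. *)
Lemma hugging_ribbon_cover c s r j : hugging_ribbon i p c s ->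
    hugging i p r j -> (j <= i + c)%N -> (r < b i)%N ->
  exists w, [/\ w \in s, crow w = r & ccol w = j].
Proof.
case: s => // z s /and5P[zs /eqP zr /eqP zc hug /andP[/eqP lr /eqP lc]] rj jc rb.
have pli : (p (i + c) <= r + (i + c - j))%N.
  by have := @top_anti j (i + c)%N; have := rj; rewrite /hugging; lia.
have rz : (r <= crow z)%N by lia.
have sz := crow_size z.
have ij : (i <= j)%N by case/and3P: rj.
have [|w ws wk] := @mem_path_content z s (j + (size la - r))%N zs.
  by rewrite /content lr lc zc; have := crow_size (last z s); lia.
exists w; have /= := hugging_inj (allP hug _ ws) rj.
have := crow_size w; move: wk; rewrite /content => wk sw.
by case=> [|-> ->] //; lia.
Qed.

Lemma mem_hugging_ribbon c s w : hugging_ribbon i p c s ->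
  (w \in s) = hugging i p (crow w) (ccol w) && (ccol w <= i + c)%N.
Proof.
move=> sP; apply/idP/andP => [ws|[hw wc]].
  case: s ws sP => // z s ws /and5P[zs _ _ /allP hug /andP[_ /eqP <-]].
  by split; [apply: hug | apply: path_ccol_le ws].
have wb : (crow w < b i)%N.
  by apply: leq_trans (ltn_crow w) (conj_part_anti _ _); case/and3P: hw.
have [v [vs vr vc]] := hugging_ribbon_cover sP hw wc wb.
by rewrite -(cell_inj vr vc).
Qed.

Lemma lower_anti c j : (i < j)%N -> (lower i c p j.+1 <= lower i c p j)%N.
Proof.
move=> ij; have := (@top_anti j.-1 j, @top_anti j j.+1, @top_anti j.-1 j.+1).
by rewrite /lower /= => -[[h1 h2] h3]; do 2 case: ifP => ?; lia.
Qed.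

(** For i < j <= i + c the position (p (j - 1), j) hugs, so it is on the ribbon and therefore a cell
    of [la]; this gives the bound by [b j]. *)
Lemma hugging_ribbon_top c s : hugging_ribbon i p c s ->
  (p i < b i)%N /\ is_top i.+1 (lower i c p).
Proof.
move=> sP; have pb : (p i < b i)%N.
  case: s sP => // z s /and5P[_ /eqP <- /eqP zc /andP[+ _] _].
  by rewrite /hugging zc => /and3P[].
split=> //; split=> j ij; first exact: lower_anti.
rewrite /lower; case: ifP => [/andP[_ jc]|_]; last by case: p_top => _ ->; lia.
have hj : hugging i p (p j.-1) j.
  by rewrite /hugging leqnn orbT top_anti; lia.
have pbi : (p j.-1 < b i)%N by have := @top_anti i j.-1; lia.
have [w [_ <- wc]] := hugging_ribbon_cover sP hj jc pbi.
by rewrite -wc ltn_crow.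
Qed.

(** The difference of the contents of the two ends. The size is thus the index of the entry in the
    first row and column [c] of the determinant. *)
Lemma hugging_ribbon_content c z s : hugging_ribbon i p c (z :: s) ->
  (size (z :: s) + p (i + c) = b i + c)%N.
Proof.
case/and5P=> zs /eqP zb /eqP zc _ /andP[/eqP lr /eqP lc].
have := path_content_last zs; rewrite /content lr lc zc /=.
by have := crow_size z; have := crow_size (last z s); rewrite lr; lia.
Qed.

(** Greedy walk: up until the profile is reached, then one step right. The bound on the lowered
    profile makes the cell to the right exist. *)
Lemma hugging_ribbon_exists c : (p i < b i)%N -> is_top i.+1 (lower i c p) ->
  exists s, hugging_ribbon i p c s.
Proof.
move=> pbi [_ low_b]; have lt_b : ((b i).-1 < b i)%N by lia.
have [z [zr zc]] := cell_at lt_b.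
have pci := @top_anti i (i + c)%N.
(* The bound on [k] is the content difference between the bottom of column [i] and the top of column
   [i + c]. *)
have walk k : (k <= (b i).-1 + c - p (i + c))%N ->
    exists s, [/\ path step z s, size s = k, (ccol (last z s) <= i + c)%N
      & all (fun w => hugging i p (crow w) (ccol w)) (z :: s)].
  elim: k => [|k IHk] kc.
    exists [::]; split=> //=; first by rewrite zc leq_addr.
    by rewrite andbT /hugging zr zc eqxx leqnn /=; lia.
  have [s [zs sk lc hug]] := IHk (ltnW kc).
  have hl : hugging i p (crow (last z s)) (ccol (last z s)).
    by apply: (allP hug); apply: mem_last.
  have kl := path_content_last zs.
  suff [w lw [hw wc]] : exists2 w, step (last z s) w &
      hugging i p (crow w) (ccol w) /\ (ccol w <= i + c)%N.
    exists (rcons s w); rewrite size_rcons sk last_rcons -rcons_cons all_rcons.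
    by rewrite rcons_path zs hw hug; split.
  have [pl|lp] := ltnP (p (ccol (last z s))) (crow (last z s)).
    have lt : ((crow (last z s)).-1 < b (ccol (last z s)))%N.
      by apply: leq_ltn_trans (ltn_crow _); apply: leq_pred.
    have [w [wr wc]] := cell_at lt; exists w.
      by rewrite /= /step_up wr wc eqxx andbT orbC; case: eqP => //=; lia.
    rewrite wc wr; split=> //; move: hl; rewrite /hugging => /and3P[-> _].
    by case: eqP => //= _ ?; lia.
  have lpe : crow (last z s) = p (ccol (last z s)).
    by apply/eqP; rewrite eqn_leq lp; case/and3P: hl.
  have ll : (i <= ccol (last z s))%N by case/and3P: hl.
  have lci : (ccol (last z s) < i + c)%N.
    rewrite ltn_neqAle lc andbT; apply/eqP => E; move: kl.
    rewrite /content lpe E sk zc zr; have := crow_size (last z s).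
    by have := crow_size z; rewrite lpe E; lia.
  have lt : (p (ccol (last z s)) < b (ccol (last z s)).+1)%N.
    by have := low_b (ccol (last z s)).+1; rewrite /lower ltnS ll lci; apply.
  have [w [wr wc]] := cell_at lt; exists w.
    by rewrite /= /step_right wr wc lpe !eqxx orbT.
  rewrite wr wc; split=> //; rewrite /hugging leqnn orbT !andbT (leqW ll) /=.
  by case: p_top => ->.
have [s [zs sk lc hug]] := walk _ (leqnn _).
exists (z :: s); rewrite /hugging_ribbon zs zr zc hug eqxx prednK ?eqxx /=;
  last by lia.
have hl : hugging i p (crow (last z s)) (ccol (last z s)).
  by apply: (allP hug); apply: mem_last.
have he : hugging i p (p (i + c)%N) (i + c).
  rewrite /hugging leq_addr leqnn /=; case: eqP => //= ne.
  by apply: top_anti; lia.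
have kl := path_content_last zs.
suff [-> ->] : crow (last z s) = p (i + c)%N /\ ccol (last z s) = (i + c)%N.
  by rewrite !eqxx.
apply: hugging_inj hl he _; move: kl; rewrite /content sk zc zr.
have := crow_size (last z s); have := crow_size z; rewrite zr.
lia.
Qed.

(** Both lists have the same cells and are strictly sorted by content. *)
Lemma hugging_ribbon_inj c s s' :
  hugging_ribbon i p c s -> hugging_ribbon i p c s' -> s = s'.
Proof.
move=> sP s'P; apply: (irr_sorted_eq content_ltn_trans).
- by move=> x /=; rewrite ltnn.
- by case: s sP => // z s /andP[/path_sorted_content].
- by case: s' s'P => // z s' /andP[/path_sorted_content].
- by move=> w; rewrite (mem_hugging_ribbon _ sP) (mem_hugging_ribbon _ s'P).
Qed.

Lemma hugging_ribbon_is_ribbon c s : hugging_ribbon i p c s -> is_ribbon s.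
Proof.
case: s => // z s /and5P[zs zb /eqP zc _ _] /=.
by rewrite column_bottomE zc zb.
Qed.

End Hugging.

(** The boolean [region i p z] is read as the number of ribbons through [z], so cells outside the
    region are avoided. For [i = 0] and the zero profile this is convertible to [is_mrt]. *)
Definition tiles i p (T : tiling la) :=
  [forall r : cell_path la in T, is_ribbon r] &&
  [forall z, #|[set r : cell_path la in T | z \in (r : seq _)]|
     == region i p z :> nat].

Lemma tiles_cover i p T (r : cell_path la) z : tiles i p T -> r \in T ->
  z \in (r : seq _) -> region i p z.
Proof.
case/andP=> _ /forallP/(_ z)/eqP Tz rT zr; move: Tz.
case: region => // /eqP; rewrite cards_eq0 => /eqP/setP/(_ r).
by rewrite !inE rT zr.
Qed.

Lemma tiles_region i p T z : tiles i p T -> region i p z ->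
  exists2 r : cell_path la, r \in T & z \in (r : seq _).
Proof.
case/andP=> _ /forallP/(_ z)/eqP Tz rz; move/eqP: Tz; rewrite rz.
by case/cards1P=> r /setP/(_ r); rewrite !inE eqxx => /andP[]; exists r.
Qed.

Lemma tiles_inj i p T (r r' : cell_path la) z : tiles i p T ->
    r \in T -> r' \in T -> z \in (r : seq _) -> z \in (r' : seq _) ->
  r = r'.
Proof.
move=> TP rT r'T zr zr'; have rz := tiles_cover TP rT zr.
case/andP: TP => _ /forallP/(_ z); rewrite rz => /cards1P[u /setP uP].
by have := uP r; have := uP r'; rewrite !inE rT r'T zr zr' => /esym/eqP-> /esym/eqP.
Qed.

Lemma tiles_ribbon i p T (r : cell_path la) :
  tiles i p T -> r \in T -> is_ribbon r.
Proof. by case/andP=> /forallP/(_ r)/implyP. Qed.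

Lemma ribbon_path s : is_ribbon s ->
  exists z s', [/\ s = z :: s', column_bottom z & path step z s'].
Proof. by case: s => // z s /andP[]; exists z, s. Qed.

(** The ribbon through the bottom of column [i] is forced: below the profile it cannot turn right
    without leaving the cell above it uncovered, and it cannot stop there either. *)
Lemma tiles_hugging i p T : is_top i p -> (p i < b i)%N -> tiles i p T ->
  exists c (r : cell_path la), r \in T /\ hugging_ribbon i p c r.
Proof.
move=> p_top pbi TP; have lt_b : ((b i).-1 < b i)%N by lia.
have [z0 [z0r z0c]] := cell_at lt_b.
have z0R : region i p z0 by rewrite /region z0r z0c leqnn; lia.
have [r rT z0_r] := tiles_region TP z0R.
have [z [s [rE zb zs]]] := ribbon_path (tiles_ribbon TP rT).
rewrite rE in z0_r.
(* The bottom cell of column [i] is the start of its ribbon: a predecessor would lie below the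
   diagram or in a column left of the region. *)
have z0z : z0 = z.
  case: (path_pred zs z0_r) => // -[v vs /orP[|]] /andP[/eqP h1 /eqP h2].
    by have := ltn_crow v; rewrite h2 z0c; lia.
  have := @tiles_cover i p T r v TP rT; rewrite rE => /(_ vs).
  by rewrite /region; lia.
subst z0; pose hug w := hugging i p (crow w) (ccol w).
(* The cell [u] above [w] is no column bottom, so its ribbon enters it from [w] or from the left.
   Since [w] hugs, the left neighbour of [u] is outside the region; hence that ribbon goes through
   [w]. *)
have up w : w \in z :: s -> hug w -> (p (ccol w) < crow w)%N ->
    exists u, [/\ u \in z :: s, content u = (content w).+1 & ccol u = ccol w].
  move=> ws /and3P[iw _ hw] pw.
  have lt : ((crow w).-1 < b (ccol w))%N.
    by apply: leq_ltn_trans (ltn_crow w); apply: leq_pred.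
  have [u [ur uc]] := cell_at lt.
  have uR : region i p u by rewrite /region ur uc iw; lia.
  have [r' r'T ur'] := tiles_region TP uR.
  have [z' [s' [r'E z'b z's']]] := ribbon_path (tiles_ribbon TP r'T).
  have ub : ~~ column_bottom u.
    by rewrite column_bottomE ur uc (ltn_predK pw) neq_ltn ltn_crow.
  have wu : step w u.
    by rewrite /= /step_up ur uc (ltn_predK pw) !eqxx.
  rewrite r'E in ur'; case: (path_pred z's' ur') => [uz'|[v vs' vu]].
    by rewrite uz' z'b in ub.
  have vR : region i p v by apply: tiles_cover TP r'T _; rewrite r'E.
  have vw : v = w.
    case/orP: vu => /andP[/eqP h1 /eqP h2].
      by apply: cell_inj; rewrite ?h1 ?h2 ?ur ?uc ?(ltn_predK pw).
    move: vR hw; rewrite /region h1 ur -uc h2 /=; clear - pw => /andP[iv pv].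
    by case/orP => [/eqP|]; lia.
  exists u; split=> //; last exact: step_content.
  suff E : r' = r by rewrite -rE -E r'E.
  by apply: (tiles_inj TP r'T rT (z := w)); rewrite ?rE // r'E -vw.
have regT w : w \in z :: s -> region i p w.
  by move=> ws; apply: tiles_cover TP rT _; rewrite rE.
have hugs k : (k <= size s)%N -> hug (nth z (z :: s) k).
  elim: k => [_|k IHk ks].
    by rewrite /hug /hugging /= z0r z0c eqxx leqnn /=; lia.
  have hk := IHk (ltnW ks); have kz : nth z (z :: s) k \in z :: s.
    by rewrite mem_nth //= ltnS ltnW.
  have kz1 : nth z (z :: s) k.+1 \in z :: s by rewrite mem_nth.
  have st := pathP z zs k ks; rewrite -[nth z s k]/(nth z (z :: s) k.+1) in st.
  have upk := up _ kz; move: (regT _ kz1) hk upk kz st.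
  move: (nth z (z :: s) k) kz1 => w; move: (nth _ _ _) => w' w's w'R hw upw ws.
  case/orP=> /andP[/eqP h1 /eqP h2].
    by move: w'R hw; rewrite /hug /hugging /region -h2 h1 => /andP[_ ->]; lia.
  (* Otherwise the cell above [w] and the cell [w'] to its right would be two cells of equal content
     on one ribbon. *)
  have wp : (crow w <= p (ccol w))%N.
    rewrite leqNgt; apply/negP => /(upw hw)[u [us uw uc]].
    have ww' : step w w' by rewrite /= /step_right h1 h2 !eqxx orbT.
    suff uw' : u = w' by move: h2; rewrite -uw' uc => /n_Sn.
    by apply: (path_content_inj zs) => //; rewrite uw (step_content ww').
  by move: w'R; rewrite /hug /hugging /region h2 -h1 wp orbT => /andP[-> ->].
have lz : last z s \in z :: s := mem_last z s.
have hl : hug (last z s) by rewrite (last_nth z) hugs.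
exists (ccol (last z s) - i)%N, r; split=> //.
have il : (i <= ccol (last z s))%N by case/and3P: hl.
rewrite rE /hugging_ribbon zs z0c z0r eqxx subnKC // eqxx prednK ?eqxx ?andbT //=;
  last by lia.
apply/andP; split.
  have := hugs 0%N isT; rewrite /hug /= z0r z0c => ->.
  apply/(all_nthP z) => k ks.
  exact: (hugs k.+1).
rewrite eqn_leq; case/and3P: (hl) => _ -> _; rewrite andbT leqNgt; apply/negP.
move=> /(up _ lz hl)[u [us uc _]].
by have := path_content_le zs us; rewrite uc ltnn andbF.
Qed.
End Ribbons.

(** * The weighted tiling sum as a determinant *)

Section RibbonSum.
Variables (R : comNzRingType) (y : nat -> R).
Hypothesis y0 : y 0%N = 1.
Variables (la : seq nat) (la_part : sorted geq la).
Local Notation b := (conj_part la).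

Definition ribbon_weight (s : seq (cell la)) : R :=
  (-1) ^+ right_steps s * y (size s).

Definition tiling_sum i p : R :=
  \sum_(T : tiling la | tiles i p T) \prod_(r in T) ribbon_weight (r : cell_path la).

Lemma ltn_ccol_head (z : cell la) : (ccol z < head 0%N la)%N.
Proof.
rewrite ltnNge; apply/negP => h; have := ltn_crow la_part z.
by rewrite (@conj_part_eq0 la (head 0%N la)) // leqnn.
Qed.

Lemma hugging_ribbon_weight i p c (s : seq (cell la)) :
  is_top la i p -> hugging_ribbon i p c s ->
  ribbon_weight s = (-1) ^+ c * y (b i + c - p (i + c))%N.
Proof.
move=> p_top; case: s => // z s sP.
have := hugging_ribbon_content la_part sP.
case/and5P: sP => zs _ /eqP zc _ /andP[_ /eqP lc].
have := path_right_steps zs; rewrite lc zc /ribbon_weight addnC => /addnI -> <-.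
by rewrite addnK.
Qed.

Lemma hugging_ribbon_bseq i p c : is_top la i p -> (p i < b i)%N ->
  is_top la i.+1 (lower i c p) ->
  exists r : cell_path la, hugging_ribbon i p c r.
Proof.
move=> h1 h2 h3; have [[|z s] // sP] := hugging_ribbon_exists la_part h1 h2 h3.
have zs : (size (z :: s) <= #|{: cell la}|)%N.
  by case/andP: (sP) => /path_size_card.
by exists (Bseq zs).
Qed.

Lemma tiles_setU1 i p c (r : cell_path la) (T : tiling la) :
    is_top la i p -> hugging_ribbon i p c r -> r \notin T ->
  tiles i p (r |: T) = tiles i.+1 (lower i c p) T.
Proof.
move=> p_top rP rT; rewrite /tiles; congr andb.
  apply/forallP/forallP => [H s|H s]; apply/implyP => sT.
    by have /implyP := H s; apply; rewrite inE sT orbT.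
  move: sT; rewrite !inE => /predU1P[->|sT].
    exact: hugging_ribbon_is_ribbon rP.
  by have /implyP := H s; apply.
apply: eq_forallb => z.
have -> : #|[set s : cell_path la in r |: T | z \in (s : seq _)]| =
    ((z \in (r : seq _)) + #|[set s : cell_path la in T | z \in (s : seq _)]|)%N.
  have [zr|zr] := boolP (z \in (r : seq _)).
    have -> : [set s : cell_path la in r |: T | z \in (s : seq _)] =
        r |: [set s : cell_path la in T | z \in (s : seq _)].
      by apply/setP => s; rewrite !inE; case: eqP => // ->; rewrite zr.
    by rewrite cardsU1 inE (negbTE rT).
  apply: eq_card => s; rewrite !inE; case: eqP => // ->.
  by rewrite (negbTE zr) !andbF.
rewrite (mem_hugging_ribbon la_part p_top _ rP).
have zL := @region_lowerE _ i p c z.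
have [zR|zR] := boolP (region i p z).
  by rewrite zL //; case: region; rewrite ?add0n ?add1n.
have /negbTE -> : ~~ hugging i p (crow z) (ccol z).
  by apply: contra zR => /and3P[h1 h2 _]; apply/andP.
suff /negbTE -> : ~~ region i.+1 (lower i c p) z by [].
apply: contra zR => /andP[h1 h2]; rewrite /region (ltnW h1) /=.
move: h2; rewrite /lower; case: ifP => // /andP[_ h3] h2.
apply: leq_trans (ltnW h2); case: p_top => /(_ (ccol z).-1).
by rewrite (ltn_predK h1) => + _; apply; rewrite -ltnS (ltn_predK h1).
Qed.

(** Tilings are sorted by the offset [c] at which the ribbon of column [i] ends; removing that
    ribbon is a bijection onto the tilings of the lowered region. The bound on [head 0%N la] keeps
    every [c] in ['I_m.+1]. *)
Lemma tiling_sum_step m i p :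
    (head 0%N la <= i + m.+1)%N -> is_top la i p -> (p i < b i)%N ->
  tiling_sum i p =
    \sum_(c < m.+1 | `[< is_top la i.+1 (lower i c p) >])
      (-1) ^+ c * y (b i + c - p (i + c))%N * tiling_sum i.+1 (lower i c p).
Proof.
move=> le_m p_top pbi; have lt_b : ((b i).-1 < b i)%N by lia.
(* The default is not reached for the [c] of the sum, for which a hugging ribbon exists. *)
pose rho (c : 'I_m.+1) : cell_path la :=
  odflt [bseq] [pick r : cell_path la | hugging_ribbon i p c r].
have rhoP (c : 'I_m.+1) : is_top la i.+1 (lower i c p) -> hugging_ribbon i p c (rho c).
  move=> /(hugging_ribbon_bseq p_top pbi)[r rP]; rewrite /rho.
  by case: pickP => //= /(_ r); rewrite rP.
have rho_end (c : 'I_m.+1) z s : rho c = z :: s :> seq _ -> hugging_ribbon i p c (rho c) ->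
    ccol (last z s) = (i + c)%N.
  by move=> -> /and5P[_ _ _ _ /andP[_ /eqP]].
have TrhoP T : tiles i p T ->
    exists2 c : 'I_m.+1, is_top la i.+1 (lower i c p) & rho c \in T.
  move=> TP; have [c [r [rT rP]]] := tiles_hugging la_part p_top pbi TP.
  have cm : (c < m.+1)%N.
    case: (bseqval r) rP => // z s /and5P[_ _ _ _ /andP[_ /eqP lc]].
    by have := ltn_ccol_head (last z s); rewrite lc; lia.
  have [_ ltop] := hugging_ribbon_top la_part p_top rP.
  exists (Ordinal cm) => //; suff -> : rho (Ordinal cm) = r by [].
  exact/val_inj/(hugging_ribbon_inj la_part p_top (rhoP (Ordinal cm) ltop) rP).
have rho_uniq T (c c' : 'I_m.+1) : tiles i p T -> is_top la i.+1 (lower i c p) ->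
    is_top la i.+1 (lower i c' p) -> rho c \in T -> rho c' \in T -> c = c'.
  move=> TP ctop ctop' cT cT'.
  have rc := rhoP c ctop; have rc' := rhoP c' ctop'.
  have E : rho c = rho c'.
    have [z [zr zc]] := cell_at la_part lt_b.
    have zh c0 : hugging i p (crow z) (ccol z) && (ccol z <= i + c0)%N.
      by rewrite /hugging zr zc eqxx leqnn leq_addr /= andbT; lia.
    apply: (tiles_inj TP cT cT' (z := z)).
      by rewrite (mem_hugging_ribbon la_part p_top _ rc) zh.
    by rewrite (mem_hugging_ribbon la_part p_top _ rc') zh.
  have := rc; case Erc: (bseqval (rho c)) => [|z s] // _.
  have := rho_end _ _ _ Erc rc; rewrite E in Erc.
  rewrite (rho_end _ _ _ Erc rc') => /addnI h; exact/val_inj/esym.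
pose endc (T : tiling la) : 'I_m.+1 :=
  odflt ord0 [pick c : 'I_m.+1 | `[< is_top la i.+1 (lower i c p) >] && (rho c \in T)].
have endcP T (c : 'I_m.+1) : tiles i p T && (endc T == c) =
    [&& `[< is_top la i.+1 (lower i c p) >], tiles i p T & rho c \in T].
  have [TP|] := boolP (tiles i p T); last by rewrite andbF.
  rewrite /= /endc; case: pickP => [c0 /andP[/asboolP top0 c0T]|none] /=.
    apply/eqP/andP => [<-|[/asboolP ctop cT]]; first by split=> //; apply/asboolP.
    exact: rho_uniq TP top0 ctop c0T cT.
  have [c0 top0 c0T] := TrhoP T TP.
  by have := none c0; rewrite c0T andbT; move/negP; case; apply/asboolP.
rewrite /tiling_sum (partition_big endc predT) //= [RHS]big_mkcond /=.
apply: eq_bigr => c _; under eq_bigl => T do rewrite endcP.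
case: asboolP => [ctop|_]; last by rewrite big_pred0.
have rP := rhoP c ctop.
(* The first cell of [rho c] is outside the lowered region, so a tiling of that region cannot
   contain [rho c]. *)
have rhoN T : tiles i.+1 (lower i c p) T -> rho c \notin T.
  move=> TP; apply/negP => rT; case Erc: (bseqval (rho c)) (rP) => [|z s] // _.
  have := tiles_cover TP rT (z := z); rewrite Erc mem_head => /(_ isT) zR.
  have := mem_hugging_ribbon la_part p_top z rP; rewrite Erc mem_head.
  move/esym; have := @region_lowerE _ i p c z.
  have -> : region i p z.
    by have := mem_hugging_ribbon la_part p_top z rP; rewrite Erc mem_head
      => /esym/andP[/and3P[h1 h2 _] _]; apply/andP.
  by rewrite zR => /(_ isT) ->.
rewrite big_distrr /= (reindex_onto (fun T => rho c |: T) (fun T => T :\ rho c));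
  last by move=> T /andP[_ /setD1K].
apply: eq_big => [T|T /andP[/andP[_ _] /eqP TE]].
  rewrite setU11 andbT; apply/andP/idP => [[TP /eqP TE]|TP].
    by rewrite -(tiles_setU1 p_top rP) // -TE setD11.
  by rewrite (tiles_setU1 p_top rP) ?TP ?setU1K ?eqxx ?rhoN.
by rewrite big_setU1 /= ?(hugging_ribbon_weight p_top rP) // -TE setD11.
Qed.

(** Induction on the number [m] of remaining columns, expanding along the first row. [m] may exceed
    the number of nonempty columns. *)
Lemma tiling_sum_det m i p : (head 0%N la <= i + m)%N -> is_top la i p ->
  tiling_sum i p =
    \det (\matrix_(a < m, c < m) shifted y (b (i + a) + c) (p (i + c) + a)).
Proof.
elim: m i p => [|m IHm] i p le_m p_top.
  rewrite det_mx00 /tiling_sum (big_pred1 set0) => [|T]; first by rewrite big_set0.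
  have reg (z : cell la) : region i p z = false.
    apply/negbTE; rewrite negb_and -ltnNge.
    by have := ltn_ccol_head z; rewrite addn0 in le_m => /leq_trans ->.
  apply/idP/eqP => [TP|->].
    apply/setP => r; rewrite inE; apply/negP => rT.
    have [z [s [rE _ _]]] := ribbon_path (tiles_ribbon TP rT).
    by have := tiles_cover TP rT (z := z); rewrite reg rE mem_head => /(_ isT).
  apply/andP; split; first by apply/forallP => r; rewrite inE.
  by apply/forallP => z; rewrite reg cards_eq0; apply/eqP/setP => r; rewrite !inE.
have pm := top_anti la_part p_top.
rewrite (expand_det_row _ ord0).
(* Columns after [c] keep their profile. A column before [c] is renumbered one place to the right,
   and the profile value of its old place plus one absorbs the shift. *)
have minorE (c : 'I_m.+1) : row' ord0 (col' c
      (\matrix_(a < m.+1, c < m.+1) shifted y (b (i + a) + c) (p (i + c) + a)))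
    = \matrix_(a < m, d < m)
        shifted y (b (i.+1 + a) + d) (lower i c p (i.+1 + d) + a).
  apply/matrixP => a d; rewrite !mxE lift0 /lower /= addSn ltnS leq_addr /=.
  rewrite addSn ltn_add2l /bump; have [cd|dc] := leqP c d.
    by rewrite add1n !addnS shiftedSS;
       congr (shifted _ _ (p _ + _)); apply: addnS.
  by rewrite !add0n !addnS addSn.
(* The lowered profile is still decreasing, so it can only fail by exceeding [b]. Beyond [i + c] it
   equals [p], so the failure lies within the [m] columns of the minor. *)
have lower_det (c : 'I_m.+1) : ~ is_top la i.+1 (lower i c p) ->
    \det (\matrix_(a < m, d < m)
        shifted y (b (i.+1 + a) + d) (lower i c p (i.+1 + d) + a)) = 0.
  move=> Ntop; have [j /andP[/andP[ij jm] bj]] : exists j, (i < j < i.+1 + m)%N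
      && (b j < lower i c p j)%N.
    apply: contrapT => Nj; apply: Ntop; split=> j ij;
      first exact: (lower_anti la_part p_top).
    have [jm|mj] := ltnP j (i.+1 + m).
      by rewrite leqNgt; apply/negP => bj; apply: Nj; exists j; rewrite ij jm.
    rewrite /lower ifN; first by case: p_top => _ ->; lia.
    by have := ltn_ord c; lia.
  apply: (@det_shifted_eq0 _ _ _ (fun a => b (i.+1 + a))
    (fun d => lower i c p (i.+1 + d)) (j - i.+1)).
  - by move=> u v uv; apply: conj_part_anti; rewrite leq_add2l.
  - move=> u v; apply: (@homo_leq _ (fun d => lower i c p (i.+1 + d))
      (fun x z => z <= x)%N) => // [x z w xz zw|x]; first exact: leq_trans xz.
    by rewrite addnS (lower_anti la_part p_top) // addSn ltnS leq_addr.
  - by lia.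
  - by rewrite subnKC.
have term (c : 'I_m.+1) :
    (\matrix_(a < m.+1, c < m.+1) shifted y (b (i + a) + c) (p (i + c) + a))
      ord0 c = y (b i + c - p (i + c))%N.
  rewrite mxE /= !addn0 /shifted ifT //.
  apply: leq_trans (pm i (i + c)%N _) _; first by rewrite leqnn leq_addr.
  by apply: leq_trans (leq_addr _ _); case: p_top => _ ->.
have [pb|bp] := ltnP (p i) (b i).
  rewrite (tiling_sum_step le_m p_top pb) big_mkcond /=; apply: eq_bigr => c _.
  rewrite /cofactor term minorE add0n; case: asboolP => [ltop|/lower_det ->].
    by rewrite -IHm ?addSnnS // mulrCA mulrA.
  by rewrite !mulr0.
(* Column [i] is empty. The first entry is [y 0 = 1], and every [c > 0] would lower the profile at
   [i.+1] to [(b i).+1], past the end of that column. *)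
have bpe : p i = b i by apply/eqP; rewrite eqn_leq bp; case: p_top => _ ->.
rewrite big_ord_recl big1 ?addr0 => [|c _]; last first.
  rewrite /cofactor minorE lower_det ?mulr0 // => -[_ /(_ i.+1 (leqnn _))].
  rewrite /lower lift0 addnS ltnSn ltnS leq_addr /= bpe => h.
  by have := conj_part_anti la (leqnSn i); rewrite leqNgt h.
rewrite /cofactor term minorE /= addn0 addn0 bpe subnn y0 mul1r expr0 mul1r.
have -> : tiling_sum i p = tiling_sum i.+1 p.
  apply: eq_bigl => T; congr andb; apply: eq_forallb => z; congr (_ == _ :> nat).
  rewrite /region; case: (ltngtP i (ccol z)) => //= iz.
  by rewrite -iz bpe iz leqNgt ltn_crow.
rewrite IHm ?addSnnS //; last by case: p_top => h1 h2; split=> j /ltnW; auto.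
congr (\det _); apply/matrixP => a d; rewrite !mxE /lower ifN //.
by rewrite addn0; lia.
Qed.
End RibbonSum.

(** * The determinant of elementary symmetric functions *)

Section ElementaryDet.
Variables (R : comNzRingType) (x : nat -> R).

Definition elem_gen k : {poly R} := \prod_(i < k) (1 + x i *: 'X).

Lemma shifted_mul1X (p : {poly R}) a u v :
  shifted (fun j => ((1 + a *: 'X) * p)`_j) u v =
    shifted (fun j => p`_j) u v + a * shifted (fun j => p`_j) u v.+1.
Proof.
rewrite /shifted; case: (ltngtP v u) => [vu|//|->].
- rewrite -(subnSK vu) mulrDl mul1r -scalerAl coefD coefZ coefXM /=.
  by rewrite subnSK.
- by rewrite mulr0 addr0.
- by rewrite subnn mulrDl mul1r -scalerAl coefD coefZ coefXM.
Qed.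

(* The columns that lose a cell: those in [E], seen as a predicate on [nat]. *)
Definition strip L (E : {set 'I_L}) c : bool := c \in [seq val a | a in E].

Lemma mem_strip L (E : {set 'I_L}) (a : 'I_L) : strip E a = (a \in E).
Proof. exact: (mem_image val_inj). Qed.

Lemma strip_ltn L (E : {set 'I_L}) c : strip E c -> (c < L)%N.
Proof. by case/imageP=> a _ ->; apply: ltn_ord. Qed.

(** Every row splits by e_j(x_0, ..., x_k) = e_j(x_0, ..., x_(k-1)) + x_k e_(j-1)(x_0, ...,
    x_(k-1)); [E] collects the rows where the second term is chosen. *)
Lemma det_elem_rec L (b : nat -> nat) k :
  \det (\matrix_(a < L, c < L) shifted (fun j => (elem_gen k.+1)`_j) (b a + c) a)
  = \sum_(E : {set 'I_L}) x k ^+ #|E| *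
      \det (\matrix_(a < L, c < L)
        shifted (fun j => (elem_gen k)`_j) (b a + c) (a + strip E a)).
Proof.
rewrite /determinant; under eq_bigr => s _.
  under eq_bigr => a _ do
    rewrite mxE /elem_gen big_ord_recr /= mulrC shifted_mul1X addrC -/(elem_gen k).
  rewrite bigA_distr big_distrr; over.
rewrite exchange_big; apply: eq_bigr => E _ /=; rewrite big_distrr /=.
apply: eq_bigr => s _; rewrite mulrCA; congr (_ * _).
rewrite -prodr_const [X in X * _]big_mkcond -big_split /=.
apply: eq_bigr => a _; rewrite mxE mem_strip; case: (a \in E).
  by rewrite addn1.
by rewrite addn0 mul1r.
Qed.

(** For decreasing [b] this says that the lengths [b c - strip E c] decrease again, so the removed
    cells form a horizontal strip. At the last index, where [b a.+1 = 0], it says that the column is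
    nonempty. *)
Definition is_strip L (E : {set 'I_L}) (b : nat -> nat) :=
  [forall a in E, (b a.+1 < b a + strip E a.+1)%N].

Section Strip.
Variables (L : nat) (b : nat -> nat).
Hypotheses (b_anti : {homo b : c d / (c <= d)%N >-> (d <= c)%N})
  (bL : forall c, (L <= c)%N -> b c = 0%N).

(** Induction from the last column backwards: a column of [E] is longer than the next one, or the
    next one is in [E] too and already known to be nonempty. *)
Lemma is_strip_gt0 (E : {set 'I_L}) c : is_strip E b -> strip E c -> (0 < b c)%N.
Proof.
move=> /forallP EP; elim: (L - c)%N {-2}c (leqnn (L - c)) => {c}[|m IHm] c cm.
  by move=> /strip_ltn; lia.
case/imageP=> a aE ca; have := EP a; rewrite aE /= -ca.
have := b_anti (leqnSn c); have [cE|_] := boolP (strip E c.+1); last by lia.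
by have := IHm c.+1 _ cE; have := ltn_ord a; rewrite -ca; lia.
Qed.

Lemma is_strip_anti (E : {set 'I_L}) : is_strip E b ->
  {homo (fun c => b c - strip E c)%N : c d / (c <= d)%N >-> (d <= c)%N}.
Proof.
move=> EP; apply: (@homo_leq _ (fun c => b c - strip E c)%N
  (fun u v => v <= u)%N) => // [v u w uv vw|c]; first exact: leq_trans uv.
have bc := b_anti (leqnSn c); have [cE|_] := boolP (strip E c); last by lia.
have c1 := @is_strip_gt0 E c.+1 EP; case/imageP: cE => a aE ca.
by have /forallP/(_ a) := EP; rewrite aE /= -ca; case: strip c1 => /= c1; lia.
Qed.

(* Two equal rows, or a zero last row. *)
Lemma det_not_strip (y : nat -> R) (E : {set 'I_L}) : ~~ is_strip E b ->
  \det (\matrix_(a < L, c < L) shifted y (b a + c) (a + strip E a)) = 0.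
Proof.
rewrite negb_forall => /existsP[a]; rewrite negb_imply -leqNgt => /andP[aE ba].
have [a1L|La1] := ltnP a.+1 L.
  apply: (@determinant_alternate _ _ _ a (Ordinal a1L)).
    by rewrite neq_ltn /= ltnSn.
  move=> c; rewrite !mxE mem_strip aE addn1 /=; have := b_anti (leqnSn a).
  by move: ba; case: strip => /= h1 h2; [lia | congr (shifted _ (_ + _)); lia].
rewrite (expand_det_row _ a) big1 // => c _; rewrite mxE mem_strip aE addn1.
by rewrite /shifted ifN ?mul0r //; move: ba; rewrite (bL La1); have := ltn_ord c; lia.
Qed.

End Strip.

(** The determinant side of the branching rule; [tableau_sum_strip] is its twin. *)
Lemma det_elem_strip L (b : nat -> nat) k :
    {homo b : c d / (c <= d)%N >-> (d <= c)%N} ->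
    (forall c, (L <= c)%N -> b c = 0%N) ->
  \det (\matrix_(a < L, c < L) shifted (fun j => (elem_gen k.+1)`_j) (b a + c) a)
  = \sum_(E : {set 'I_L} | is_strip E b) x k ^+ #|E| *
      \det (\matrix_(a < L, c < L)
        shifted (fun j => (elem_gen k)`_j) (b a - strip E a + c) a).
Proof.
move=> b_anti bL; rewrite det_elem_rec [RHS]big_mkcond; apply: eq_bigr => E _.
case: ifP => [EP|/negbT/det_not_strip ->]; rewrite ?mulr0 //.
congr (_ * \det _); apply/matrixP => a c; rewrite !mxE.
have [aE|_] := boolP (strip E a); last by rewrite subn0 addn0.
have := is_strip_gt0 b_anti EP aE; case: (b a) => // ba _.
by rewrite addn1 subSS subn0 addSn shiftedSS.
Qed.

End ElementaryDet.

(** * The same branching rule for semistandard tableaux *)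

Section TableauSum.
Variables (R : comNzRingType) (la : seq nat) (la_part : sorted geq la) (M : nat).
Variable x : nat -> R.
Implicit Types (b : nat -> nat) (z w : cell la) (T : {ffun cell la -> 'I_M.+1}).

(** Shapes are column lengths [b] inside a fixed [la], so that all tableaux of the recursion live in
    one finite type. *)
Definition inside b z := (crow z < b (ccol z))%N.

(* The semistandard tableaux of column lengths [b] with entries smaller than
   [k]; the cells outside of [b] get the dummy value [ord0]. *)
Definition subtableau k b T :=
  [forall z, if inside b z then (T z < k)%N else T z == ord0] &&
  [forall z, forall w, inside b z && inside b w ==>
      ((crow z == crow w) && (ccol z <= ccol w)%N ==> (T z <= T w)%N)
   && ((ccol z == ccol w) && (crow z < crow w)%N ==> (T z < T w)%N)].

Definition tableau_sum k b : R :=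
  \sum_(T | subtableau k b T) \prod_(z | inside b z) x (T z).

Lemma subtableauP k b T : reflect
  [/\ forall z, inside b z -> (T z < k)%N, forall z, ~~ inside b z -> T z = ord0,
      forall z w, inside b z -> inside b w -> crow z = crow w ->
        (ccol z <= ccol w)%N -> (T z <= T w)%N
    & forall z w, inside b z -> inside b w -> ccol z = ccol w ->
        (crow z < crow w)%N -> (T z < T w)%N]
  (subtableau k b T).
Proof.
apply: (iffP andP) => [[/forallP T1 /forallP T2]|[T1 T2 T3 T4]].
  split=> [z zb|z /negbTE zb|z w zb wb zw le|z w zb wb zw lt].
  - by have := T1 z; rewrite zb.
  - by have := T1 z; rewrite zb => /eqP.
  - by have /forallP/(_ w) := T2 z; rewrite zb wb zw le eqxx => /andP[].
  - by have /forallP/(_ w) := T2 z; rewrite zb wb zw lt eqxx => /andP[].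
split; first by apply/forallP => z; case: ifPn => [/T1 //|/T2 ->].
apply/forallP => z; apply/forallP => w; apply/implyP => /andP[zb wb].
apply/andP; split; apply/implyP => /andP[/eqP zw h]; first exact: T3.
exact: T4.
Qed.

Section Branching.
Variables (L k : nat) (b : nat -> nat) (kM : (k < M.+1)%N).
Hypotheses (b_anti : {homo b : c d / (c <= d)%N >-> (d <= c)%N})
  (bL : forall c, (L <= c)%N -> b c = 0%N)
  (b_la : forall c, (b c <= conj_part la c)%N).
Implicit Type E : {set 'I_L}.

Definition trim E c := (b c - strip E c)%N.

Definition strip_of T : {set 'I_L} :=
  [set a : 'I_L | [exists z, [&& ccol z == a, inside b z & T z == k :> nat]]].

Lemma strip_ofP T c : reflect
  (exists z, [/\ ccol z = c, inside b z & T z = k :> nat]) (strip (strip_of T) c).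
Proof.
apply: (iffP idP) => [cE|[z [zc zb Tz]]].
  have := mem_strip (strip_of T) (Ordinal (strip_ltn cE)); rewrite /= cE inE.
  by move=> /esym/existsP[z /and3P[/eqP ? ? /eqP ?]]; exists z.
have cL : (c < L)%N.
  by rewrite ltnNge; apply/negP => /bL bc; move: zb; rewrite /inside zc bc.
rewrite -[c]/(val (Ordinal cL)) mem_strip inE; apply/existsP; exists z.
by rewrite zc zb Tz !eqxx.
Qed.

Lemma strip_bottom T z w : subtableau k.+1 b T ->
    inside b z -> inside b w -> ccol z = ccol w -> T z = k :> nat ->
  (crow w <= crow z)%N.
Proof.
case/subtableauP => T1 _ _ T4 zb wb zw Tz; rewrite leqNgt; apply/negP => lt.
by have := T4 _ _ zb wb zw lt; have := T1 _ wb; rewrite Tz; lia.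
Qed.

Lemma cell_bottom c : (0 < b c)%N ->
  exists z, [/\ crow z = (b c).-1, ccol z = c & inside b z].
Proof.
move=> bc; have lt : ((b c).-1 < conj_part la c)%N.
  by rewrite prednK //; apply: b_la.
have [z [zr zc]] := cell_at la_part lt.
by exists z; rewrite /inside zr zc prednK.
Qed.

Lemma insideN_trim E z : is_strip E b -> inside b z ->
  ~~ inside (trim E) z = strip E (ccol z) && (crow z == (b (ccol z)).-1).
Proof.
move=> /is_strip_gt0 E0; rewrite /inside /trim => zb.
have := E0 b_anti (ccol z); case: strip => /= [/(_ isT)|_]; last by rewrite subn0 zb.
by lia.
Qed.

Lemma sub_trim E z : inside (trim E) z -> inside b z.
Proof. by move=> /leq_trans; apply; apply: leq_subr. Qed.

Lemma subtableau_strip T z : subtableau k.+1 b T -> inside b z ->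
  (T z == k :> nat) = strip (strip_of T) (ccol z) && (crow z == (b (ccol z)).-1).
Proof.
move=> TP zb; apply/eqP/andP => [Tz|[/strip_ofP[w [wz wb Tw]] /eqP zr]].
  split; first by apply/strip_ofP; exists z.
  have b0 : (0 < b (ccol z))%N by apply: leq_ltn_trans zb.
  have [w [wr wc wb]] := cell_bottom b0.
  have := strip_bottom TP zb wb (esym wc) Tz; rewrite wr.
  by move: zb; rewrite /inside; lia.
have zw := strip_bottom TP wb zb wz Tw.
rewrite -Tw; congr (nat_of_ord (T _)); apply: cell_inj => //.
by move: wb; rewrite /inside wz; lia.
Qed.

(** If column [a] ends in [k] and the next column is equally long, weak increase along the bottom
    row forces [k] there as well. *)
Lemma strip_of_is_strip T : subtableau k.+1 b T -> is_strip (strip_of T) b.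
Proof.
move=> TP; apply/forallP => a; apply/implyP => aE.
have /strip_ofP[z [za zb Tz]] : strip (strip_of T) a by rewrite mem_strip.
have := b_anti (leqnSn a); case: (strip_ofP T a.+1) => [_|noE].
  by rewrite addn1 ltnS.
rewrite addn0 ltn_neqAle => ->; rewrite andbT; apply/eqP => ba.
have zr : crow z = (b a).-1.
  by have := subtableau_strip TP zb; rewrite Tz eqxx za => /esym/andP[_ /eqP].
have b0 : (0 < b a.+1)%N by rewrite ba -za; apply: leq_ltn_trans zb.
have [w [wr wc wb]] := cell_bottom b0.
apply: noE; exists w; split=> //; case/subtableauP: TP => T1 _ T3 _.
have := T1 w wb; have := T3 z w zb wb; rewrite zr wr ba wc za Tz.
by move=> /(_ erefl (leqnSn _)); lia.
Qed.

(** [fill] and [cut] are the two directions of the bijection that removes the entries [k], the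
    largest ones allowed. *)
Definition fill E T : {ffun cell la -> 'I_M.+1} :=
  [ffun z => if inside (trim E) z then T z
             else if inside b z then Ordinal kM else ord0].

Definition cut E T : {ffun cell la -> 'I_M.+1} :=
  [ffun z => if inside (trim E) z then T z else ord0].

Lemma cutK E T : subtableau k.+1 b T -> is_strip E b -> strip_of T = E ->
  fill E (cut E T) = T.
Proof.
move=> TP EP TE; apply/ffunP => z; rewrite !ffunE.
case: (boolP (inside (trim E) z)) => // zE.
case: ifPn => zb; last by case/subtableauP: TP => _ T2 _ _; rewrite T2.
apply/val_inj/esym/eqP; rewrite /= (subtableau_strip TP zb) TE.
by rewrite -insideN_trim.
Qed.

Lemma cut_subtableau E T : subtableau k.+1 b T -> is_strip E b ->
  strip_of T = E -> subtableau k (trim E) (cut E T).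
Proof.
move=> TP EP TE; case/subtableauP: (TP) => T1 T2 T3 T4.
apply/subtableauP; split=> [z zE|z /negbTE zE|z w zE wE|z w zE wE];
  rewrite !ffunE ?zE ?wE //.
- have zb := sub_trim zE; have := T1 z zb; rewrite ltnS leq_eqVlt.
  by rewrite (subtableau_strip TP zb) TE -insideN_trim // zE.
- exact: T3 (sub_trim zE) (sub_trim wE).
- exact: T4 (sub_trim zE) (sub_trim wE).
Qed.

Lemma fill_subtableau E T : subtableau k (trim E) T -> is_strip E b ->
  subtableau k.+1 b (fill E T) /\ strip_of (fill E T) = E.
Proof.
move=> TP EP; case/subtableauP: (TP) => T1 T2 T3 T4.
have fillE z : inside b z ->
    (fill E T z == k :> nat) = ~~ inside (trim E) z.
  move=> zb; rewrite ffunE zb; case: ifPn => [/T1|_]; rewrite ?eqxx //.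
  by rewrite ltn_neqAle => /andP[/negbTE].
have trim_anti := is_strip_anti b_anti EP.
have fk z : inside b z -> (fill E T z <= k)%N.
  by move=> zb; rewrite ffunE zb; case: ifPn => [/T1/ltnW|_].
split.
  apply/subtableauP; split=> [z zb|z zb|z w zb wb zw le|z w zb wb zw lt].
  - by rewrite ltnS fk.
  - by rewrite ffunE (negbTE zb) ifN //; apply: contra zb; apply: sub_trim.
  - have [wE|wE] := boolP (inside (trim E) w); last first.
      by have /eqP -> : fill E T w == k :> nat; rewrite ?fillE ?fk.
    have zE : inside (trim E) z.
      by rewrite /inside zw; apply: leq_trans wE (trim_anti _ _ le).
    by rewrite !ffunE zE wE T3.
  - have zE : inside (trim E) z.
      apply: contraT => zN; have := insideN_trim EP zb; rewrite zN.
      move=> /esym/andP[_ /eqP zr]; have wb' := wb.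
      by move: wb' lt; rewrite /inside zr -zw; lia.
    have [wE|wE] := boolP (inside (trim E) w).
      by rewrite !ffunE zE wE T4.
    have /eqP -> : fill E T w == k :> nat by rewrite fillE.
    by rewrite ffunE zE T1.
apply/setP => a; rewrite -!mem_strip; apply/strip_ofP/idP => [[z [za zb zk]]|aE].
  have := fillE z zb; rewrite zk eqxx => /esym; rewrite insideN_trim //.
  by rewrite za => /andP[].
have [z [zr zc zb]] := cell_bottom (is_strip_gt0 b_anti EP aE).
exists z; split=> //; apply/eqP; rewrite fillE // insideN_trim //.
by rewrite zc aE zr eqxx.
Qed.

Lemma fillK E T : subtableau k (trim E) T -> cut E (fill E T) = T.
Proof.
case/subtableauP => _ T2 _ _; apply/ffunP => z; rewrite !ffunE.
by case: (boolP (inside (trim E) z)) => // /T2.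
Qed.

Lemma card_strip E : is_strip E b ->
  #|[pred z | inside b z && ~~ inside (trim E) z]| = #|E|.
Proof.
move=> EP; rewrite -(size_image (@ccol la)) -(size_image val E).
apply/perm_size/uniq_perm => [||c].
- rewrite map_inj_in_uniq ?enum_uniq // => z w; rewrite !mem_enum !inE.
  move=> /andP[zb zN] /andP[wb wN] zw; apply: cell_inj => //.
  move: zN wN; rewrite !insideN_trim // zw.
  by move=> /andP[_ /eqP ->] /andP[_ /eqP ->].
- by rewrite (map_inj_uniq val_inj) enum_uniq.
- apply/imageP/idP => [[z /andP[zb zN] ->]|cE].
    by move: zN; rewrite insideN_trim // => /andP[].
  have [z [zr zc zb]] := cell_bottom (is_strip_gt0 b_anti EP cE).
  by exists z; rewrite // inE zb insideN_trim // zc zr eqxx andbT.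
Qed.

Lemma tableau_sum_strip : tableau_sum k.+1 b =
  \sum_(E : {set 'I_L} | is_strip E b) x k ^+ #|E| * tableau_sum k (trim E).
Proof.
rewrite /tableau_sum (partition_big strip_of (fun E => is_strip E b)) /=;
  last exact: strip_of_is_strip.
apply: eq_bigr => E EP; rewrite big_distrr /=.
rewrite (reindex_onto (fill E) (cut E)) /=; last first.
  by move=> T /andP[TP /eqP]; apply: cutK.
apply: eq_big => [T|T].
  apply/andP/idP => [[/andP[TP /eqP TE] /eqP <-]|TP].
    exact: cut_subtableau.
  by have [-> ->] := fill_subtableau TP EP; rewrite fillK // !eqxx.
move=> _; rewrite (bigID (inside (trim E))) /= mulrC; congr (_ * _).
  rewrite -(card_strip EP) -prodr_const; apply: eq_bigr => z /andP[zb /negbTE zE].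
  by rewrite ffunE zE zb.
apply: eq_big => z; last by move=> /andP[_ zE]; rewrite ffunE zE.
by rewrite andbC; case zE: inside => //; apply: sub_trim zE.
Qed.

End Branching.
End TableauSum.

Lemma tableau_sum_det (R : comNzRingType) (la : seq nat) M (x : nat -> R) L k b :
    sorted geq la -> (k <= M.+1)%N ->
    {homo b : c d / (c <= d)%N >-> (d <= c)%N} ->
    (forall c, (L <= c)%N -> b c = 0%N) ->
    (forall c, (b c <= conj_part la c)%N) ->
  @tableau_sum R la M x k b =
    \det (\matrix_(a < L, c < L)
      shifted (fun j => (elem_gen x k)`_j) (b a + c) a).
Proof.
move=> la_part; elim: k b => [|k IHk] b kM b_anti bL b_la; last first.
  rewrite (tableau_sum_strip la_part _ kM b_anti bL b_la) det_elem_strip //.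
  apply: eq_bigr => E EP; rewrite IHk //; first exact: ltnW.
  - exact: is_strip_anti.
  - by move=> c /bL bc; rewrite /trim bc.
  - by move=> c; apply: leq_trans (leq_subr _ _) (b_la c).
(* Without variables e_j is 1 for j = 0 and 0 otherwise: a nonempty shape has a zero first row and
   no tableau, the empty shape gives the identity matrix and one filling. *)
have e0 u v : shifted (fun j => (elem_gen x 0)`_j) u v = (u == v)%:R.
  rewrite /shifted /elem_gen big_ord0; case: (ltngtP v u) => // [vu|->].
    by rewrite coef1 subn_eq0 leqNgt vu.
  by rewrite coef1 subnn.
have [/existsP[z zb]|] := boolP [exists z : cell la, inside b z].
  rewrite /tableau_sum big1 => [|T /subtableauP[/(_ z zb)]] //.
  have zL : (0 < L)%N.
    by rewrite lt0n; apply/eqP => L0; move: zb; rewrite /inside bL ?L0.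
  have b0 : (0 < b 0)%N.
    by apply: leq_trans (b_anti 0%N _ (leq0n (ccol z))); apply: leq_ltn_trans zb.
  rewrite (expand_det_row _ (Ordinal zL)) big1 // => c _.
  by rewrite mxE e0 /= gtn_eqF ?mul0r // addn_gt0 b0.
rewrite negb_exists => /forallP Nb.
have b0 c : b c = 0%N.
  apply/eqP; rewrite -leqn0 -ltnS; have := b_la c; case: (posnP (b c)) => [-> //|].
  move=> b0 lab; have [z [zr zc]] := cell_at la_part (leq_trans b0 lab).
  by have := Nb z; rewrite /inside zr zc b0.
rewrite (_ : \matrix_(a, c) _ = 1%:M) ?det1; last first.
  by apply/matrixP => a c; rewrite !mxE e0 b0 add0n eq_sym.
rewrite /tableau_sum (big_pred1 [ffun=> ord0]) => [|T].
  by rewrite big_pred0 // => z; apply/negbTE.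
apply/subtableauP/eqP => [[_ T0 _ _]|->].
  by apply/ffunP => z; rewrite ffunE T0.
split=> [z|z _|z w|z w]; rewrite ?ffunE ?(negbTE (Nb z)) //.
Qed.

Lemma coef_elem_gen (K : comNzRingType) N j :
  (elem_gen (fun i => 'X_(inord i) : {mpoly K[N.+1]}) N.+1)`_j = elem_poly K N.+1 j.
Proof.
rewrite /elem_gen; under eq_bigr => i _ do rewrite addrC inord_val.
rewrite bigA_distr coef_sum /elem_poly /mesym [RHS]big_mkcond /=.
apply: eq_bigr => J _; rewrite -big_mkcond /= scaler_prod prodr_const.
by rewrite coefZ coefXn eq_sym; case: eqP; rewrite ?mulr1 ?mulr0.
Qed.

Lemma schur_poly_det (K : comNzRingType) (la : seq nat) L N :
    sorted geq la -> (head 0%N la <= L)%N ->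
  schur_poly K N.+1 la = \det (\matrix_(a < L, c < L)
    shifted (elem_poly K N.+1) (conj_part la a + c) a).
Proof.
move=> la_part hL; pose x i : {mpoly K[N.+1]} := 'X_(inord i).
transitivity (@tableau_sum _ la N x N.+1 (conj_part la)); last first.
  rewrite (@tableau_sum_det _ _ _ _ L) //; last first.
  - by move=> c Lc; apply: (conj_part_eq0 (N := L)); rewrite // hL.
  - by move=> c d; apply: conj_part_anti.
  congr (\det _); apply/matrixP => a c; rewrite !mxE /shifted.
  by case: ifP; rewrite ?coef_elem_gen.
have ins (z : cell la) : inside (conj_part la) z by apply: ltn_crow.
apply: eq_big => T; last by move=> _; apply: eq_big => z; rewrite ?ins // /x inord_val.
rewrite /subtableau; under [X in _ = X && _]eq_forallb => z do rewrite ins ltn_ord.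
have -> : [forall z : cell la, true] by apply/forallP.
apply: eq_forallb => z; apply: eq_forallb => w; rewrite !ins //.
Qed.

(** * Partitions and their column lengths *)

Lemma count_ltn_iota k m : (k <= m)%N -> count (fun r => r < k)%N (iota 0 m) = k.
Proof.
move=> km; rewrite -size_filter -[RHS](size_iota 0); congr size.
exact: (@filter_iota_ltn 0 m k).
Qed.

Lemma sumn_conj_part la m : all (fun x => x <= m)%N la ->
  sumn (mkseq (conj_part la) m) = sumn la.
Proof.
elim: la => [|x la IHla] /=.
  by rewrite /mkseq (eq_map (g := fun=> 0%N)) // => _; elim: (iota _ _).
move=> /andP[xm /IHla <-]; rewrite -[in RHS](count_ltn_iota xm) /mkseq.
elim: (iota 0 m) => //= r s ->; rewrite /conj_part; lia.
Qed.

Lemma sum_conj_part n (la : intpart n) N : (n <= N)%N ->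
  (\sum_(c < N) conj_part la c)%N = n.
Proof.
move=> nN; have [_ lan] := strong_compP la.
rewrite -[RHS]lan -(@sumn_conj_part la N).
  by rewrite sumnE big_map -[N in iota 0 N]subn0 big_mkord.
by apply/allP => x /strong_comp_le/leq_trans; apply.
Qed.

Lemma head_intpart n (la : intpart n) : (head 0%N la <= n)%N.
Proof.
case E: (la : seq nat) => [|x s] //=; apply: (@strong_comp_le n la).
by rewrite E mem_head.
Qed.

(** As there are no zero parts, column 0 gives the number of rows; each row is then read off through
    [ltn_conj_part]. *)
Lemma conj_part_inj n (la la' : intpart n) :
  (forall c, conj_part la c = conj_part la' c) -> la = la'.
Proof.
move=> cE; have sz (nu : intpart n) : size nu = conj_part nu 0.
  have [nu0 _] := strong_compP nu; rewrite /conj_part; apply/esym/eqP.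
  rewrite -all_count; apply/allP => x xnu; rewrite lt0n.
  by apply: contraNneq nu0 => <-.
have nthE r : nth 0%N la r = nth 0%N la' r.
  have h c : (c < nth 0%N la r)%N = (c < nth 0%N la' r)%N.
    by rewrite -!ltn_conj_part ?cE //; apply: intpart_sorted.
  move: h; move: (nth 0%N la r) (nth 0%N la' r) => u v h.
  by have := h u; have := h v; lia.
have E : la = la' :> seq nat.
  by apply: (@eq_from_nth _ 0%N) => [|r _]; rewrite ?sz ?cE.
exact/val_inj/val_inj.
Qed.

Lemma conj_part_surj n N (b : nat -> nat) :
    {homo b : c d / (c <= d)%N >-> (d <= c)%N} ->
    (forall c, (N <= c)%N -> b c = 0%N) -> (\sum_(c < N) b c)%N = n ->
  exists la : intpart n, forall c, conj_part la c = b c.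
Proof.
(* The witness is the conjugate of [b], since conjugating twice gives [b] back. *)
move=> b_anti bN bn; pose B := mkseq b N; pose la := mkseq (conj_part B) (b 0%N).
have nthB c : nth 0%N B c = b c.
  have [cN|Nc] := ltnP c N; first by rewrite nth_mkseq.
  by rewrite nth_default ?size_mkseq // bN.
have B_sorted : sorted geq B.
  apply/(sortedP 0%N) => c; rewrite size_mkseq => cN.
  by rewrite !nthB; apply: b_anti.
have la_conj c : conj_part la c = b c.
  rewrite /conj_part count_map -[RHS](count_ltn_iota (b_anti 0%N c _)) //.
  by apply: eq_count => r /=; rewrite ltn_conj_part // nthB.
have laP : (0%N \notin la) && (sumn la == n).
  apply/andP; split.
    apply/negP => /mapP[r]; rewrite mem_iota /= add0n => rb /esym/eqP.
    by rewrite -leqn0 leqNgt ltn_conj_part // nthB rb.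
  rewrite sumn_conj_part; last first.
    by apply/allP => _ /mapP[c _ ->]; apply: b_anti.
  by rewrite /B sumnE big_map -[N in iota 0 N]subn0 big_mkord bn.
have la_sorted : sorted geq la.
  apply/(sortedP 0%N) => r; rewrite size_mkseq => rb.
  by rewrite !nth_mkseq // ?(ltnW rb) //; apply: conj_part_anti.
by exists (@IntPart n (StrongComp laP) la_sorted).
Qed.

(** * Alternants *)

Section CompleteDet.
Variables (K : comNzRingType) (N : nat).
Local Notation A := {mpoly K[N]}.

(** The series of the h_k with each geometric factor cut at degree [d], which keeps it a polynomial
    and does not change the coefficients below [d]. *)
Definition complete_gen d : {poly A} :=
  \prod_(i < N) \sum_(j < d) ('X_i *: 'X) ^+ j.

Lemma coef_complete_gen d k : (k < d)%N ->
  (complete_gen d)`_k = complete_poly K N k.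
Proof.
move=> kd; rewrite /complete_gen bigA_distr_bigA /= coef_sum.
apply/mpolyP => m; rewrite mcoeff_complete_poly raddf_sum /=.
have termE (f : {ffun 'I_N -> 'I_d}) : (\prod_i ('X_i *: 'X : {poly A}) ^+ f i)`_k =
    if (\sum_i f i == k)%N then 'X_[[multinom f i : nat | i < N]] else 0.
  under eq_bigr => i _ do rewrite exprZn.
  have -> : 'X_[[multinom f i : nat | i < N]] = \prod_i 'X_i ^+ f i :> A.
    by rewrite [LHS]mpolyXE_id; apply: eq_bigr => i _; rewrite mnmE.
  rewrite scaler_prod prodrXr coefZ coefXn eq_sym.
  by case: eqP; rewrite ?mulr1 ?mulr0.
under eq_bigr => f _ do rewrite termE.
have [mk|mk] := eqVneq (mdeg m) k.
  have md i : (m i < d)%N.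
    by apply: leq_ltn_trans kd; rewrite -mk mdegE (bigD1 i) //= leq_addr.
  pose f0 := [ffun i => Ordinal (md i)].
  have f0m : [multinom f0 i : nat | i < N] = m.
    by apply/mnmP => i; rewrite mnmE ffunE.
  rewrite (bigD1 f0) //= [X in _ + X]big1 ?addr0 => [|f ff0].
    have -> : (\sum_i f0 i)%N = k.
      by rewrite -mk mdegE; apply: eq_bigr => i _; rewrite ffunE.
    by rewrite eqxx f0m mcoeffX eqxx.
  case: ifP => _; rewrite ?mcoeff0 // mcoeffX; case: eqP => // fm.
  by case/eqP: ff0; apply/ffunP => i; apply/val_inj; rewrite ffunE /= -fm mnmE.
apply: big1 => f _; case: eqP => [fk|_]; rewrite ?mcoeff0 // mcoeffX.
case: eqP => // fm; case/eqP: mk; rewrite -fm mdegE -fk.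
by apply: eq_bigr => i _; rewrite mnmE.
Qed.

Definition cofactor_gen (i : 'I_N) : {poly A} :=
  \prod_(j < N | j != i) (1 - 'X_j *: 'X).

Lemma size_cofactor_gen i : (size (cofactor_gen i) <= N)%N.
Proof.
apply: leq_trans (size_prod_leq _ _) _.
have le2 : (\sum_(j < N | j != i) size (1 - 'X_j *: 'X : {poly A})%R
    <= #|[pred j : 'I_N | j != i]| * 2)%N.
  rewrite -sum_nat_const; apply: leq_sum => j _.
  apply: leq_trans (size_polyD _ _) _; rewrite size_poly1 size_polyN geq_max /=.
  by apply: leq_trans (size_scale_leq _ _) _; rewrite size_polyX.
have : (#|[pred j : 'I_N | j != i]|).+1 = N.
  have := cardC1 i; rewrite card_ord => E.
  by rewrite -[LHS]/(#|predC1 i|.+1) E prednK // (leq_trans _ (ltn_ord i)).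
by move: le2; set u := #|_|; set v := \sum_(j < _ | _) _; lia.
Qed.

(** Each factor with j != i telescopes to 1 - (X_j t)^d, which is 1 modulo t^d; only the geometric
    series of X_i is left. *)
Lemma coef_complete_cofactor_gen d i l : (l < d)%N ->
  (complete_gen d * cofactor_gen i)`_l = 'X_i ^+ l.
Proof.
move=> ld; rewrite /complete_gen (bigD1 i) //= -mulrA -big_split /=.
have [q ->] : exists q, \prod_(j < N | j != i)
    ((\sum_(k < d) ('X_j *: 'X) ^+ k) * (1 - 'X_j *: 'X)) = 1 + q * 'X^d :> {poly A}.
  apply: (big_ind (fun p => exists q, p = 1 + q * 'X^d)).
  - by exists 0; rewrite mul0r addr0.
  - move=> _ _ [p ->] [q ->]; exists (p + q + p * q * 'X^d).
    by ring.
  - move=> j _; exists (- ('X_j ^+ d)%:P).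
    rewrite mulrC -opprB mulNr -subrX1 opprB exprZn mulNr mul_polyC //.
rewrite mulrDr mulr1 mulrA coefD coefMXn ld addr0 coef_sum.
rewrite (bigD1 (Ordinal ld)) //= big1 ?addr0 => [|j].
  by rewrite exprZn coefZ coefXn eqxx mulr1.
by rewrite exprZn coefZ coefXn -val_eqE eq_sym /= => /negbTE ->; rewrite mulr0.
Qed.

Definition alternant (l : 'I_N -> nat) : A :=
  \det (\matrix_(i < N, a < N) 'X_i ^+ l a).

(** The entry (a, i) of the matrix product is a convolution of total degree (b_a - a) + (N - 1) =
    b_a + [rev_ord a], hence a power of X_i. *)
Lemma complete_det_cofactor (b : nat -> nat) :
  \det (\matrix_(a < N, c < N) shifted (complete_poly K N) (b a + c) a) *
    \det (\matrix_(c < N, i < N) (cofactor_gen i)`_(rev_ord c)) =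
  alternant (fun a => b a + rev_ord a)%N.
Proof.
rewrite -det_mulmx /alternant -det_tr; congr (\det _).
apply/matrixP => i a; rewrite !mxE (reindex_inj rev_ord_inj).
set l := (b a + _)%N; rewrite -(coef_complete_cofactor_gen i (ltnSn l)) coefMr.
have aN := ltn_ord a.
pose F d := shifted (fun k => (complete_gen l.+1)`_k) l d * (cofactor_gen i)`_d.
transitivity (\sum_(d < N) F d).
  apply: eq_bigr => d _; rewrite !mxE rev_ordK /F /shifted /=.
  have dN := ltn_ord d; congr (_ * _).
  have -> : (a <= b a + (N - d.+1))%N = (d <= l)%N by rewrite /l /=; lia.
  case: ifP => // dl; rewrite coef_complete_gen; last by lia.
  by congr complete_poly; rewrite /l /=; lia.
(* The matrix product runs over d < N and the convolution over d <= l. [F] vanishes past either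
   bound, so both sums extend to the larger range. *)
have F0 d : (N <= d)%N || (l < d)%N -> F d = 0.
  case/orP=> h; first by rewrite /F [X in _ * X]nth_default ?mulr0 //
    (leq_trans (size_cofactor_gen i)).
  by rewrite /F /shifted leqNgt h mul0r.
transitivity (\sum_(d < l.+1) F d); last first.
  by apply: eq_bigr => d _; rewrite /F /shifted -ltnS ltn_ord.
rewrite !(big_ord_widen_cond (maxn N l.+1) xpredT F) ?leq_max ?leqnn ?orbT //.
rewrite big_mkcond [RHS]big_mkcond; apply: eq_bigr => d _ /=.
by case: ltnP => h; case: ltnP => h' //; rewrite F0 ?h ?h' ?orbT.
Qed.

(** For b = 0 the matrix of the h_k is unitriangular, so the cofactor determinant is itself the
    alternant of delta. *)
Lemma complete_det_alternant (b : nat -> nat) :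
  \det (\matrix_(a < N, c < N) shifted (complete_poly K N) (b a + c) a) *
    alternant (@rev_ord N) = alternant (fun a => b a + rev_ord a)%N.
Proof.
rewrite -complete_det_cofactor; congr (_ * _).
have := complete_det_cofactor (fun=> 0%N).
rewrite -det_tr det_trig; last first.
  apply/is_trig_mxP => a c ac; rewrite !mxE /shifted add0n leqNgt ac //.
rewrite big1 ?mul1r => [-> //|a _].
rewrite !mxE /shifted add0n leqnn subnn.
apply/mpolyP => m; rewrite mcoeff_complete_poly mcoeff1.
by rewrite mdeg_eq0.
Qed.

End CompleteDet.

(** * Strictly decreasing exponents *)

Section StrictlyDecreasing.
Variable N : nat.
Implicit Types (l m : 'I_N -> nat) (s : 'S_N).

Definition strict l := forall i j : 'I_N, (i < j)%N -> (l j < l i)%N.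

(** Both [s] and its inverse are increasing, and an increasing permutation moves no index down. *)
Lemma strict_perm_id l s : strict l -> strict (l \o s) -> s = 1%g.
Proof.
have mono_ge (t : 'S_N) : (forall i j : 'I_N, (i < j)%N -> (t i < t j)%N) ->
    forall i : 'I_N, (i <= t i)%N.
  move=> tP [j]; elim: j => // j IHj jN /=.
  exact: leq_ltn_trans (IHj (ltnW jN)) (tP (Ordinal (ltnW jN)) (Ordinal jN) _).
move=> lP lsP; have s_mono (i j : 'I_N) : (i < j)%N -> (s i < s j)%N.
  move=> ij; rewrite ltnNge leq_eqVlt; apply/negP => /predU1P[/val_inj/perm_inj ji|].
    by rewrite ji ltnn in ij.
  by move/lP; have := lsP _ _ ij; rewrite /= => h1 h2; lia.
have sV_mono (i j : 'I_N) : (i < j)%N -> (s^-1%g i < s^-1%g j)%N.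
  move=> ij; rewrite ltnNge leq_eqVlt; apply/negP => /predU1P[/val_inj/perm_inj ji|].
    by rewrite ji ltnn in ij.
  by move/s_mono; rewrite !permKV ltnNge (ltnW ij).
apply/permP => i; rewrite perm1; apply/val_inj/eqP; rewrite eqn_leq.
by have := mono_ge _ sV_mono (s i); rewrite permK => ->; apply: mono_ge.
Qed.

Lemma sort_strict m : injective m -> exists s, strict (m \o s).
Proof.
move=> m_inj; pose t := [tuple m i | i < N].
have /tuple_permP[s tE] : perm_eq (sort_tuple geq t) t by rewrite perm_sort.
have t_sorted : sorted gtn (sort geq t).
  rewrite gtn_sorted_uniq_geq sort_uniq; apply/andP; split.
    by apply/tuple_uniqP => u v; rewrite !tnth_mktuple => /m_inj.
  by apply: sort_sorted => x y; apply: leq_total.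
exists s => i j ij; have gtn_trans : transitive gtn by move=> x y z xy /ltn_trans; apply.
have ms k : nth 0%N (sort geq t) (k : 'I_N) = m (s k).
  rewrite -[sort geq t]/(tval (sort_tuple geq t)) tE.
  rewrite -[LHS]/(nth 0%N (mktuple (fun i => tnth t (s i))) k) -tnth_nth.
  by rewrite !tnth_mktuple.
rewrite /= -!ms; apply: (sorted_ltn_nth gtn_trans 0%N t_sorted) => //;
  by rewrite inE size_tuple.
Qed.

Lemma strict_ge l (i : 'I_N) : strict l -> (rev_ord i <= l i)%N.
Proof.
move=> lP; have [k kN] : exists k, k = rev_ord i :> nat by exists (rev_ord i).
elim: k i kN => [|k IHk] i /= ki; first by rewrite -ki.
have i1N : (i.+1 < N)%N by lia.
have kN : k = rev_ord (Ordinal i1N) by rewrite /=; lia.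
by have := IHk _ kN; have := lP i (Ordinal i1N) (ltnSn i); rewrite /=; lia.
Qed.

Lemma strict_rev_ord (b : nat -> nat) :
    {homo b : c d / (c <= d)%N >-> (d <= c)%N} ->
  strict (fun i => b i + rev_ord i)%N.
Proof.
by move=> b_anti i j ij; have := b_anti _ _ (ltnW ij); have := ltn_ord j => /=; lia.
Qed.

End StrictlyDecreasing.

(** * Antisymmetric polynomials and their coefficients *)

Section Alternants.
Variables (K : numDomainType) (N : nat).
Local Notation A := {mpoly K[N]}.
Implicit Types (p q : A) (l : 'I_N -> nat) (m : 'X_{1..N}) (s t : 'S_N).

Lemma alternantE l : alternant K l =
  \sum_(s : 'S_N) (-1) ^+ s *: 'X_[[multinom l (s i) | i < N]].
Proof.
apply: eq_bigr => s _; rewrite -mul_mpolyC rmorphXn rmorphN rmorph1.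
congr (_ * _); rewrite [RHS]mpolyXE_id; apply: eq_bigr => i _.
by rewrite mxE mnmE.
Qed.

Lemma mcoeff_alternant l m : (alternant K l)@_m =
  \sum_(s : 'S_N) (-1) ^+ s * ([forall i, l (s i) == m i])%:R.
Proof.
rewrite alternantE raddf_sum /=; apply: eq_bigr => s _.
rewrite mcoeffZ mcoeffX; congr (_ * (_%:R)); congr nat_of_bool.
by apply/eqP/forallP => [<- i|H]; [rewrite mnmE | apply/mnmP => i; rewrite mnmE; apply/eqP].
Qed.

Definition antisymmetric p := forall s, msym s p = (-1) ^+ s *: p.

Lemma antisymmetric_alternant l : antisymmetric (alternant K l).
Proof.
move=> t; apply/mpolyP => m; rewrite mcoeff_sym mcoeffZ !mcoeff_alternant.
rewrite big_distrr /= (reindex_inj (mulgI t)) /=; apply: eq_bigr => s _.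
rewrite odd_permM signr_addb mulrA; congr (_ * (_%:R)); congr nat_of_bool.
apply/forallP/forallP => H i.
  by have := H (t^-1 i)%g; rewrite permM mnmE permKV.
by rewrite permM mnmE.
Qed.

Lemma antisymmetricB p q :
  antisymmetric p -> antisymmetric q -> antisymmetric (p - q).
Proof. by move=> pP qP s; rewrite msymB pP qP scalerBr. Qed.

Lemma antisymmetric_sum (I : finType) (c : I -> K) (F : I -> A) :
  (forall i, antisymmetric (F i)) -> antisymmetric (\sum_i c i *: F i).
Proof.
move=> FP s; rewrite raddf_sum scaler_sumr; apply: eq_bigr => i _ /=.
by rewrite msymZ FP !scalerA mulrC.
Qed.

Lemma antisymmetricMl p q :
  p \is symmetric -> antisymmetric q -> antisymmetric (p * q).
Proof.
move=> /issymP pP qP s; rewrite msymM pP qP -scalerAr //.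
Qed.

(** Distinct exponents can be sorted at the cost of a sign. If two exponents agree, their
    transposition makes the coefficient its own opposite, hence 0 in a [numDomainType]. *)
Lemma antisymmetric_eq0 p : antisymmetric p ->
  (forall m, strict m -> p@_m = 0) -> p = 0.
Proof.
move=> pP p0; apply/mpolyP => m; rewrite mcoeff0.
have pE s : p@_[multinom m (s i) | i < N] = (-1) ^+ s * p@_m.
  by rewrite -mcoeffZ -pP mcoeff_sym.
have [/injectiveP m_inj|] := boolP (injectiveb m).
  have [s ms] := sort_strict m_inj.
  have := pE s; rewrite p0 => [|i j ij]; last by rewrite !mnmE; apply: ms.
  by move/esym/eqP; rewrite mulf_eq0 signr_eq0 => /eqP.
move=> /injectivePn[i [j ij mij]]; have := pE (tperm i j).
rewrite (_ : [multinom _ | _ < _] = m); last first.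
  by apply/mnmP => k; rewrite mnmE; case: tpermP => // ->.
rewrite odd_tperm ij expr1 mulN1r => /eqP.
by rewrite eq_sym Num.Theory.eqNr => /eqP.
Qed.

Lemma mcoeffMX_leq p m k :
  (p * 'X_[k])@_m = if [forall i, k i <= m i]%N then p@_(m - k)%MM else 0.
Proof.
case: ifPn => [/forallP km|].
  have mE : m = (k + (m - k))%MM by rewrite addmC submK //; apply/mnm_lepP.
  by rewrite [in LHS]mE mcoeffMX.
move=> /forallPn[i kmi]; rewrite [p]mpolyE mulr_suml raddf_sum big1 //= => m' _.
rewrite -scalerAl mcoeffZ -mpolyXD mcoeffX; case: eqP; rewrite ?mulr0 // => mE.
by case/negP: kmi; rewrite -mE mnmDE leq_addl.
Qed.

Lemma mcoeff_alternant_strict l m : strict l -> strict m ->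
  (alternant K l)@_m = ([forall i, l i == m i])%:R.
Proof.
move=> lP mP; rewrite mcoeff_alternant (bigD1 1%g) //= big1 ?addr0 => [|s s1].
  rewrite odd_perm1 mul1r; congr (_%:R); congr nat_of_bool.
  by apply: eq_forallb => i; rewrite perm1.
case: forallP => [H|_]; rewrite ?mulr0 //; case/eqP: s1.
apply: strict_perm_id lP _ => i j /mP; by rewrite /= !(eqP (H _)).
Qed.

Lemma alternant_rev_ord_neq0 : alternant K (@rev_ord N) != 0.
Proof.
apply/eqP => /(congr1 (mcoeff [multinom (@rev_ord N i : nat) | i < N])).
rewrite mcoeff0 mcoeff_alternant_strict.
- case: forallP => [_ /eqP|[]]; first by rewrite oner_eq0.
  by move=> i; rewrite mnmE.
- exact: (@strict_rev_ord N (fun=> 0%N)).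
- move=> i j ij; rewrite !mnmE; exact: (@strict_rev_ord N (fun=> 0%N)).
Qed.

End Alternants.

(** * Expansion of m_mu a_delta in alternants *)

Section MonomialAlternant.
Variable K : numDomainType.

(* The coefficient of [h_mu] in the expansion of the Jacobi-Trudi determinant
   [det (h_(b i - i + j))]. *)
Definition jacobi_trudi_coef N (mu : seq nat) (b : nat -> nat) : K :=
  \sum_(s : 'S_N) (-1) ^+ s *
    ([forall i : 'I_N, i <= b i + s i]%N &&
     (sort geq [seq j <- [seq (b i + s i - i)%N | i : 'I_N] | j != 0%N] == mu))%:R.

Lemma eq_jacobi_trudi_coef N mu (b b' : nat -> nat) : (forall i : 'I_N, b i = b' i) ->
  jacobi_trudi_coef N mu b = jacobi_trudi_coef N mu b'.
Proof.
move=> bb'; apply: eq_bigr => s _; congr (_ * (_ && _)%:R).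
  by apply: eq_forallb => i; rewrite bb'.
by congr (sort _ (filter _ _) == _); apply: eq_map => i; rewrite bb'.
Qed.

Lemma sumn_sort_filter (s : seq nat) :
  sumn (sort geq [seq j <- s | j != 0%N]) = sumn s.
Proof. by rewrite (perm_sumn (permEl (perm_sort _ _))) sumn_filter_neq0. Qed.

(** Dividing by the term of [s] in a_delta leaves the exponents b_i + (N - 1 - i) - (N - 1 - s i) =
    b_i + s i - i, which are the indices on the diagonal of [s] in the determinant. *)
Lemma mcoeff_mon_alternant N mu (m : 'X_{1..N}) (b : nat -> nat) :
    (forall i : 'I_N, m i = b i + rev_ord i)%N ->
  (mon_poly K N mu * alternant K (@rev_ord N))@_m = jacobi_trudi_coef N mu b.
Proof.
move=> mb; rewrite alternantE mulr_sumr raddf_sum /=; apply: eq_bigr => s _.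
rewrite -scalerAr mcoeffZ mcoeffMX_leq; congr (_ * _).
have -> : [forall i, [multinom rev_ord (s i) : nat | i < N] i <= m i]%N =
    [forall i : 'I_N, i <= b i + s i]%N.
  apply: eq_forallb => i; rewrite mnmE mb /=.
  by have := ltn_ord i; have := ltn_ord (s i); lia.
case: forallP => [bs|_] //=; rewrite mcoeff_mon_poly.
have -> : (m - [multinom rev_ord (s i) : nat | i < N])%MM =
    [multinom (b i + s i - i)%N | i < N].
  apply/mnmP => i; rewrite mnmBE !mnmE mb /=; have := bs i.
  by have := ltn_ord i; have := ltn_ord (s i); lia.
by [].
Qed.

Lemma sumn_jacobi_trudi N (b : nat -> nat) (s : 'S_N) :
    (forall i : 'I_N, i <= b i + s i)%N ->
  sumn [seq (b i + s i - i)%N | i : 'I_N] = (\sum_(i < N) b i)%N.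
Proof.
move=> bs; rewrite sumnE big_map big_enum /=.
have sE : (\sum_(i < N) s i = \sum_(i < N) i)%N.
  by rewrite [RHS](reindex_inj (@perm_inj _ s)).
apply: (@addIn (\sum_(i < N) i)%N); rewrite -[in RHS]sE -!big_split.
by apply: eq_bigr => i _ /=; rewrite subnK.
Qed.

Lemma jacobi_trudi_coef_neq0 N mu b : jacobi_trudi_coef N mu b != 0 ->
  (\sum_(i < N) b i)%N = sumn mu.
Proof.
apply: contraNeq => bmu; rewrite /jacobi_trudi_coef big1 // => s _.
case: forallP => [bs|_]; rewrite ?mulr0 //; case: eqP => [E|_]; rewrite ?mulr0 //.
by case/eqP: bmu; rewrite -E sumn_sort_filter sumn_jacobi_trudi.
Qed.

(** Both sides are antisymmetric, so strict exponents suffice. Such an exponent is b + delta with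
    [b] decreasing: if [b] sums to n, it belongs to exactly one [la]; otherwise both coefficients
    vanish. *)
Lemma mon_poly_alternant n N mu : (n <= N)%N -> sumn mu = n ->
  mon_poly K N mu * alternant K (@rev_ord N) =
    \sum_(la : intpart n) jacobi_trudi_coef N mu (conj_part la) *:
      alternant K (fun i : 'I_N => conj_part la i + rev_ord i)%N.
Proof.
move=> nN mun; apply/eqP; rewrite -subr_eq0; apply/eqP.
have conj_anti (la : intpart n) :
    {homo conj_part la : c d / (c <= d)%N >-> (d <= c)%N}.
  by move=> c d; apply: conj_part_anti.
have conj0 (la : intpart n) c : (N <= c)%N -> conj_part la c = 0%N.
  move=> Nc; apply: (@conj_part_eq0 la N); first exact: intpart_sorted.
  by rewrite Nc (leq_trans (head_intpart la)).
apply: antisymmetric_eq0 => [|m mP].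
  apply: antisymmetricB.
    apply: antisymmetricMl; last exact: antisymmetric_alternant.
    by case: (mon_poly_symfun K mu).
  by apply: antisymmetric_sum => la; apply: antisymmetric_alternant.
pose b c := if insub c is Some i then (m i - @rev_ord N i)%N else 0%N.
have bE (i : 'I_N) : b i = (m i - rev_ord i)%N by rewrite /b valK.
have mb (i : 'I_N) : m i = (b i + rev_ord i)%N.
  by rewrite bE subnK // strict_ge.
have b0 c : (N <= c)%N -> b c = 0%N by move=> Nc; rewrite /b insubF // ltnNge Nc.
have b_anti : {homo b : c d / (c <= d)%N >-> (d <= c)%N}.
  apply: (@homo_leq _ b (fun u v => v <= u)%N) => // [v u w uv vw|c].
    exact: leq_trans uv.
  have [cN|Nc] := ltnP c.+1 N; last by rewrite b0.
  have := mP (Ordinal (ltnW cN)) (Ordinal cN) (ltnSn c).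
  by rewrite !mb /=; lia.
rewrite mcoeffB (mcoeff_mon_alternant _ mb) raddf_sum /=.
have alt_m (la : intpart n) :
    (alternant K (fun i : 'I_N => conj_part la i + rev_ord i)%N)@_m =
    ([forall i : 'I_N, conj_part la i == b i])%:R.
  rewrite mcoeff_alternant_strict //; last exact: strict_rev_ord.
  by congr (_%:R); congr nat_of_bool; apply: eq_forallb => i; rewrite mb eqn_add2r.
under eq_bigr => la _ do rewrite mcoeffZ alt_m.
have [/eqP bn|bn] := boolP ((\sum_(i < N) b i)%N == n).
  have [la laE] := conj_part_surj b_anti b0 bn.
  rewrite (bigD1 la) //= big1 ?addr0 => [|la' la'E].
    rewrite (eq_jacobi_trudi_coef _ (b' := b)) //.
    by case: forallP => [_|[]]; rewrite ?mulr1 ?subrr // => i; rewrite laE.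
  case: forallP => [H|_]; rewrite ?mulr0 //; case/eqP: la'E.
  apply: conj_part_inj => c; have [cN|Nc] := ltnP c N; last by rewrite !conj0.
  by rewrite laE (eqP (H (Ordinal cN))).
have -> : jacobi_trudi_coef N mu b = 0.
  by apply: contraNeq bn => /jacobi_trudi_coef_neq0 ->; rewrite mun.
rewrite big1 ?subr0 // => la _; case: forallP => [H|_]; rewrite ?mulr0 //.
case/eqP: bn; rewrite -(sum_conj_part la nN); apply: eq_bigr => i _.
exact/esym/eqP.
Qed.

End MonomialAlternant.

(** * Symmetric functions *)

Section SymFunDet.
Variable K : comNzRingType.

Definition symfun_eval N (f : symfun K) : {mpoly K[N]} := f N.

Fact symfun_eval_is_zmod_morphism N : zmod_morphism (symfun_eval N).
Proof. by []. Qed.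

Fact symfun_eval_is_monoid_morphism N : monoid_morphism (symfun_eval N).
Proof. by []. Qed.

HB.instance Definition _ N := GRing.isZmodMorphism.Build (symfun K) {mpoly K[N]}
  (symfun_eval N) (symfun_eval_is_zmod_morphism N).
HB.instance Definition _ N := GRing.isMonoidMorphism.Build (symfun K) {mpoly K[N]}
  (symfun_eval N) (symfun_eval_is_monoid_morphism N).

(** Setting variables to 0 recovers the lower components, so identities valid only for many
    variables suffice. *)
Lemma symfun_ext_geq N0 (f g : symfun K) :
  (forall N, (N0 <= N)%N -> f N = g N) -> f = g.
Proof.
move=> fg; apply: symfun_ext => N.
have [_ fr _] := symfunP f; have [_ gr _] := symfunP g.
suff down d M : (N0 <= M + d)%N -> f M = g M by apply: (down N0); apply: leq_addl.
elim: d M => [|d IHd] M; first by rewrite addn0; apply: fg.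
by rewrite -addSnnS => /IHd E; rewrite -fr -gr E.
Qed.

Definition elem_symfun k := mkSymFun (elem_poly_symfun K k).
Definition complete_symfun k := mkSymFun (complete_poly_symfun K k).

Lemma schur_det n (la : intpart n) L : (n <= L)%N ->
  schur K la = \det (\matrix_(a < L, c < L)
    shifted elem_symfun (conj_part la a + c) a).
Proof.
move=> nL; apply: (@symfun_ext_geq 1) => -[|N] // _.
rewrite -[LHS]/(schur_poly K N.+1 la) -[RHS]/(symfun_eval N.+1 _) -det_map_mx.
rewrite (@schur_poly_det _ _ L) ?(leq_trans (head_intpart la)) //;
  last exact: intpart_sorted.
congr (\det _); apply/matrixP => a c; rewrite !mxE /shifted.
by case: ifP; rewrite ?rmorph0.
Qed.

Lemma omega_elem (omega : {lrmorphism symfun K -> symfun K}) k :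
  is_omega omega -> omega (elem_symfun k) = complete_symfun k.
Proof.
(* [is_omega] concerns positive parts; e_0 and h_0 are both 1 and are treated apart. *)
case=> _ omegaE; case: k => [|k].
  have -> : elem_symfun 0 = 1 by apply: symfun_ext => N; apply: mesym0E.
  rewrite rmorph1; apply: symfun_ext => N; apply/mpolyP => m /=.
  by rewrite mcoeff_complete_poly mcoeff1 mdeg_eq0.
have kP : (0%N \notin [:: k.+1]) && (sumn [:: k.+1] == k.+1).
  by rewrite inE /= addn0 eqxx.
have := omegaE k.+1 (@IntPart k.+1 (StrongComp kP) isT).
by rewrite /elementary /complete !big_seq1.
Qed.

Lemma omega_schur (omega : {lrmorphism symfun K -> symfun K}) n (la : intpart n) L :
    is_omega omega -> (n <= L)%N ->
  omega (schur K la) = \det (\matrix_(a < L, c < L)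
    shifted complete_symfun (conj_part la a + c) a).
Proof.
move=> omegaP nL; rewrite (schur_det la nL) -det_map_mx; congr (\det _).
apply/matrixP => a c; rewrite !mxE /shifted.
by case: ifP => _; [apply: omega_elem | apply: rmorph0].
Qed.

End SymFunDet.

(** * Signed tiling counts as coefficients of the determinant *)

Section RibbonTilingCoefficient.
Variables (K : numDomainType) (n : nat).

(* Generic weights: [part_var k] is the [k]-th variable for [0 < k <= n], and
   [1] for [k = 0]. *)
Definition part_var (k : nat) : {mpoly K[n]} := 'X_[[multinom (i.+1 == k : nat) | i < n]].

Lemma prod_part_var (s : seq nat) :
  \prod_(k <- s) part_var k = 'X_[[multinom count_mem i.+1 s | i < n]].
Proof.
elim: s => [|k s IHs].
  by rewrite big_nil -[LHS]mpolyX0; congr 'X_[_]; apply/mnmP => i; rewrite !mnmE.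
rewrite big_cons IHs -mpolyXD; congr 'X_[_]; apply/mnmP => i.
by rewrite mnmDE !mnmE /= eq_sym.
Qed.

(** The monomial records the multiset of nonzero entries. The bound on the entries matters:
    [part_var k] is also 1 for k > n, so a larger entry would leave no trace. *)
Lemma mcoeff_prod_part_var (mu : intpart n) (s : seq nat) :
    all (fun k => k <= n)%N s ->
  (\prod_(k <- s) part_var k)@_[multinom count_mem i.+1 mu | i < n] =
    (sort geq [seq k <- s | k != 0%N] == mu)%:R.
Proof.
move=> /allP sn; rewrite prod_part_var mcoeffX; congr (_%:R); congr nat_of_bool.
have [mu0 _] := strong_compP mu.
have count0 (t : seq nat) k : (0 < k)%N -> count_mem k [seq k <- t | k != 0%N] = count_mem k t.
  move=> k0; rewrite count_filter; apply: eq_count => j /=.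
  by case: eqP => // ->; rewrite -lt0n.
apply/eqP/eqP => [/mnmP E|<-].
  apply: (sorted_eq (leT := geq)).
  - by move=> y u v uy /leq_trans; apply.
  - by move=> u v; rewrite andbC; apply: anti_leq.
  - by apply: sort_sorted => u v; apply: leq_total.
  - exact: intpart_sorted.
  rewrite perm_sort; apply/allP => k _ /=; apply/eqP.
  have [->|k0] := posnP k.
    rewrite (count_memPn mu0); apply/count_memPn.
    by rewrite mem_filter.
  rewrite count0 //; have [kn|nk] := leqP k n.
    have k1n : (k.-1 < n)%N by rewrite prednK.
    by have := E (Ordinal k1n); rewrite !mnmE /= prednK.
  have /count_memPn -> : k \notin s by apply/negP => /sn; rewrite leqNgt nk.
  by apply/esym/count_memPn/negP => /strong_comp_le; rewrite leqNgt nk.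
apply/mnmP => i; rewrite !mnmE count_sort count0 //.
Qed.

Variable la : intpart n.
Local Notation cell_path := (cell_path la).

Lemma card_cell : #|{: cell la}| = n.
Proof.
have [_ lan] := strong_compP la; rewrite -[RHS]lan card_tagged !sumnE.
rewrite big_map big_enum (big_nth 0%N) big_mkord /=.
by apply: eq_bigr => i _; rewrite card_ord.
Qed.

Lemma perm_mrt_type (T : tiling la) :
  perm_eq (mrt_type T) [seq size (r : cell_path) | r <- enum T].
Proof. by apply: perm_map; rewrite perm_sort. Qed.

Lemma mrt_ribbon (T : tiling la) (r : cell_path) : is_mrt T -> r \in T ->
  uniq r /\ size r = (right_steps r + up_steps r).+1.
Proof.
move=> TP rT; have TP0 : tiles 0 (fun=> 0%N) T := TP.
have [z [s [-> _ zs]]] := ribbon_path (tiles_ribbon TP0 rT).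
split; first exact: path_uniq zs.
have := path_up_steps zs; have := path_ccol_le zs (mem_head z s).
by rewrite /right_steps /=; lia.
Qed.

Lemma sum_size_mrt (T : tiling la) : is_mrt T ->
  (\sum_(r in T) size (r : cell_path))%N = n.
Proof.
move=> TP; transitivity (\sum_(z : cell la) 1)%N; last first.
  by rewrite sum1_card card_cell.
transitivity (\sum_(r in T) \sum_(z | z \in (r : cell_path)) 1)%N.
  apply: eq_bigr => r rT; rewrite sum1_card.
  by have [/card_uniqP <- _] := mrt_ribbon TP rT.
rewrite (exchange_big_dep predT) //=; apply: eq_bigr => z _.
case/andP: TP => _ /forallP/(_ z)/eqP Tz; rewrite sum1dep_card -[RHS]Tz.
by apply: eq_card => r; rewrite !inE.
Qed.

Lemma size_mrt_type (T : tiling la) : size (mrt_type T) = #|T|.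
Proof. by rewrite (perm_size (perm_mrt_type T)) size_map -cardE. Qed.

(** Summing size = right steps + up steps + 1 over the tiling gives n minus the number of ribbons as
    the total number of steps. *)
Lemma prod_ribbon_weight (T : tiling la) : is_mrt T ->
  \prod_(r in T) ribbon_weight part_var (r : cell_path) =
    ((-1) ^+ (n - size (mrt_type T)) * mrt_sign K T)
      *: \prod_(k <- mrt_type T) part_var k.
Proof.
move=> TP; rewrite big_split /= prodrXr (perm_big _ (perm_mrt_type T)) big_map.
rewrite big_enum /= -mul_mpolyC; congr (_ * _).
rewrite /mrt_sign size_mrt_type -sum1_card rmorphM !rmorphXn rmorphN rmorph1.
have sizeE : (\sum_(r in T) size (r : cell_path) = (\sum_(r in T)
    right_steps (r : cell_path) + \sum_(r in T) up_steps r) + \sum_(r in T) 1)%N.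
  rewrite -!big_split; apply: eq_bigr => r /(mrt_ribbon TP)[_ ->] /=.
  by rewrite addn1.
rewrite (sum_size_mrt TP) in sizeE.
have -> : (n - \sum_(r in T) 1 =
    \sum_(r in T) right_steps (r : cell_path) + \sum_(r in T) up_steps r)%N.
  by have := congr1 (subn^~ (\sum_(r in T) 1)%N) sizeE; rewrite /= addnK.
by rewrite exprD -mulrA -expr2 sqrr_sign mulr1.
Qed.

Lemma mrt_type_neq0 (T : tiling la) : is_mrt T -> 0%N \notin mrt_type T.
Proof.
move=> TP; rewrite (perm_mem (perm_mrt_type T)); apply/negP => /mapP[r].
by rewrite mem_enum => /(mrt_ribbon TP)[_ ->].
Qed.

Lemma sumn_mrt_type (T : tiling la) : is_mrt T -> sumn (mrt_type T) = n.
Proof.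
move=> TP; rewrite (perm_sumn (perm_mrt_type T)) sumnE big_map big_enum.
exact: sum_size_mrt.
Qed.

Lemma mcoeff_tiling_sum (mu : intpart n) :
  (tiling_sum part_var la 0 (fun=> 0%N))@_[multinom count_mem i.+1 mu | i < n] =
    (-1) ^+ (n - size mu) *
      \sum_(al : strong_comp n | sort geq al == mu :> seq nat)
        \sum_(T in MRT la al) mrt_sign K T.
Proof.
rewrite raddf_sum /= big_distrr /=.
transitivity (\sum_(T : tiling la | is_mrt T && (sort geq (mrt_type T) == mu))
    (-1) ^+ (n - size mu) * mrt_sign K T).
  rewrite [RHS]big_mkcondr; apply: eq_big => // T TP0.
  have TP : is_mrt T := TP0; rewrite prod_ribbon_weight //.
  rewrite mcoeffZ mcoeff_prod_part_var; last first.
    by apply/allP => k /mem_le_sumn; rewrite sumn_mrt_type.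
  rewrite (all_filterP _); last first.
    by apply/allP => k kT; apply: contraNneq (mrt_type_neq0 TP) => <-.
  by case: eqP => [<-|_]; rewrite ?mulr0 // mulr1 size_sort.
under [RHS]eq_bigr => al _ do rewrite big_distrr.
(* Each tiling has a single type, so the sum over [al] collapses. *)
rewrite (exchange_big_dep [pred T : tiling la | is_mrt T && (sort geq (mrt_type T) == mu)])
  /=; last by move=> al T /eqP <-; rewrite inE => /andP[-> /eqP ->]; rewrite eqxx.
apply: eq_bigr => T /andP[TP /eqP Tmu].
have typeP : (0%N \notin mrt_type T) && (sumn (mrt_type T) == n).
  by rewrite mrt_type_neq0 ?sumn_mrt_type ?eqxx.
rewrite (big_pred1 (StrongComp typeP)) // => al.
rewrite inE TP /= -(inj_eq val_inj) /= [RHS]eq_sym.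
by case: (mrt_type T =P al) => [<-|_]; rewrite ?andbF // Tmu eqxx.
Qed.

Lemma mcoeff_det_part_var (mu : intpart n) N : (n <= N)%N ->
  (\det (\matrix_(a < N, c < N) shifted part_var (conj_part la a + c) a))
      @_[multinom count_mem i.+1 mu | i < n] =
    jacobi_trudi_coef K N mu (conj_part la).
Proof.
move=> nN; rewrite /determinant raddf_sum /=; apply: eq_bigr => s _.
rewrite mulr_sign -scaler_sign mcoeffZ; congr (_ * _).
case: (boolP [forall i : 'I_N, _]) => [/forallP bs|/forallPn[i bi]] /=; last first.
  rewrite (bigD1 i) //= mxE /shifted (negbTE bi).
  by rewrite mul0r mcoeff0.
rewrite -mcoeff_prod_part_var; last first.
  apply/allP => k /mem_le_sumn.
  by rewrite sumn_jacobi_trudi ?sum_conj_part.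
congr (_@__); rewrite big_map big_enum; apply: eq_bigr => i _.
by rewrite mxE /shifted bs.
Qed.

(** Two evaluations of one coefficient of [tiling_sum], by tilings and by the determinant. The size
    [N] of the matrix is free, and the left side does not involve it. *)
Lemma sum_mrt_sign (mu : intpart n) N : (n <= N)%N ->
  \sum_(al : strong_comp n | sort geq al == mu :> seq nat)
      \sum_(T in MRT la al) mrt_sign K T =
    (-1) ^+ (n - size mu) * jacobi_trudi_coef K N mu (conj_part la).
Proof.
move=> nN; rewrite -mcoeff_det_part_var //.
have topP : is_top la 0 (fun=> 0%N) by [].
have y0 : part_var 0 = 1.
  by rewrite -[RHS]mpolyX0; congr 'X_[_]; apply/mnmP => i; rewrite !mnmE.
have hN : (head 0%N la <= 0 + N)%N by apply: leq_trans (head_intpart la) nN.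
have := @tiling_sum_det _ part_var y0 la (intpart_sorted la) N 0 _ hN topP.
move=> /(congr1 (mcoeff [multinom count_mem i.+1 mu | i < n])).
rewrite mcoeff_tiling_sum => <-.
by rewrite mulrA -expr2 sqrr_sign mul1r.
Qed.

End RibbonTilingCoefficient.

(** * Monomial and forgotten functions in terms of Schur functions *)

Section ForgottenSchur.
Variable K : numDomainType.

(** Up to one common sign both numbers are the same tiling sum. *)
Lemma jacobi_trudi_coef_stable n (mu la : intpart n) N : (n <= N)%N ->
  jacobi_trudi_coef K N mu (conj_part la) = jacobi_trudi_coef K n mu (conj_part la).
Proof.
move=> nN; have := @sum_mrt_sign K n la mu N nN.
rewrite (@sum_mrt_sign K n la mu n (leqnn n)) => /esym.
by apply: mulfI; rewrite signr_eq0.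
Qed.

Lemma monomial_omega_schur (omega : {lrmorphism symfun K -> symfun K}) n
    (mu : intpart n) : is_omega omega ->
  monomial K mu = \sum_(la : intpart n)
    jacobi_trudi_coef K n mu (conj_part la) *: omega (schur K la).
Proof.
move=> omegaP; apply: (@symfun_ext_geq _ n) => N nN.
(* The alternant of delta is nonzero, so it can be cancelled; multiplied by it, the determinant of
   the h_k becomes an alternant. *)
apply: (mulIf (alternant_rev_ord_neq0 K N)).
have [_ mun] := strong_compP mu.
rewrite [LHS](mon_poly_alternant K nN mun) -[X in X * _]/(symfun_eval N _).
rewrite raddf_sum mulr_suml; apply: eq_bigr => la _.
rewrite jacobi_trudi_coef_stable // -complete_det_alternant (omega_schur la omegaP nN).
rewrite scalerAl; congr (_ * _).
rewrite -[RHS]/(_ *: symfun_eval N (\det _)) -det_map_mx; congr (_ *: \det _).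
apply/matrixP => a c; rewrite !mxE /shifted.
by case: ifP.
Qed.

Lemma forgotten_schur (omega : {lrmorphism symfun K -> symfun K}) n
    (mu : intpart n) : is_omega omega ->
  forgotten omega mu = \sum_(la : intpart n)
    jacobi_trudi_coef K n mu (conj_part la) *: schur K la.
Proof.
move=> omegaP; have [omegaK _] := omegaP.
rewrite /forgotten (monomial_omega_schur mu omegaP) linear_sum.
by apply: eq_bigr => la _; rewrite linearZ /= omegaK.
Qed.

End ForgottenSchur.

Theorem theorem3p4 (R : realType)
    (omega : {lrmorphism symfun R[i] -> symfun R[i]})
    (omegaP : is_omega omega)
    (n : nat) (mu : intpart n) :
  (-1) ^+ (n - size mu) *: forgotten omega mu =
    \sum_(la : intpart n)
      (\sum_(al : strong_comp n | sort geq al == mu :> seq nat)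
         \sum_(T in MRT la al) mrt_sign R[i] T)
      *: schur R[i] la.
Proof.
rewrite (forgotten_schur mu omegaP) scaler_sumr; apply: eq_bigr => la _.
by rewrite scalerA (sum_mrt_sign _ la mu (leqnn n)).
Qed.
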